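(* Let $(a_n)_{n\ge 0}$ and $(b_n)_{n\ge1}$ be sequences of complex numbers, let $\rho_n=\sqrt{|a_n|^2+|b_n|^2}$, and suppose that $$\sum_{n=1}^{N} n\rho_n = O(N)\quad (N\to\infty).$$ Fix $x_0\in\mathbb{R}$, $s(x_0)\in\mathbb{C}$, and $\beta>0$. Then the following statements are equivalent. The trigonometric series $\frac{a_0}{2}+\sum_{n=1}^{\infty}(a_n\cos nx+b_n\sin nx)$ is: (i) Lebesgue summable at $x=x_0$ to $s(x_0)$; (ii) Abel summable at $x=x_0$ to $s(x_0)$; (iii) $(\mathrm{C},\beta)$ summable at $x=x_0$ to $s(x_0)$; (iv) $(\mathfrak{R},1)$ summable at $x=x_0$ to $s(x_0)$; (v) $(\mathfrak{R},2)$ summable at $x=x_0$ to $s(x_0)$.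
   Context: Write $c_0=a_0/2$ and $c_n=a_n\cos nx_0+b_n\sin nx_0$ for $n\ge1$; summability of the trigonometric series at $x_0$ means summability of $\sum_{n\ge0}c_n$. Lebesgue summability: the series is Lebesgue summable at $x_0$ to $s(x_0)$ if the formally integrated series $L(x)=\frac{a_0x}{2}+\sum_{n=1}^\infty\left(\frac{a_n}{n}\sin nx-\frac{b_n}{n}\cos nx\right)$ converges for all $x$ in a neighborhood of $x_0$ and $$s(x_0)=\lim_{h\to0}\frac{L(x_0+h)-L(x_0-h)}{2h}=\lim_{h\to 0}\Big(\frac{a_0}{2}+\sum_{n=1}^\infty(a_n\cos nx_0+b_n\sin nx_0)\frac{\sin nh}{nh}\Big).$$ Abel summability: $\sum_n c_n r^n$ converges for $0<r<1$ and tends to $s(x_0)$ as $r\to1^-$. $(\mathrm{C},\beta)$ is the usual Ces\`aro summability of order $\beta$. Riemann summability: for $\kappa>0$ let $\gamma_\kappa(x)=\frac{\kappa}{x}\int_0^x(1-t/x)^{\kappa-1}\cos t\,dt$, so $\gamma_1(x)=\frac{\sin x}{x}$ and $\gamma_2(x)=\left(\frac{\sin(x/2)}{x/2}\right)^2$ (with $\gamma_\kappa(0)=1$). The series is $(\mathfrak{R},\kappa)$ summable ($\kappa=1,2$) to $s(x_0)$ if $\sum_{n=0}^\infty c_n\gamma_\kappa(nh)$ converges for all sufficiently small $h>0$ and $\lim_{h\to0^+}\sum_{n=0}^\infty c_n\gamma_\kappa(nh)=s(x_0)$. *)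

(* Defs.v *)
From Stdlib Require Import Reals.
From Coquelicot Require Import Coquelicot.
Open Scope R_scope.

Definition series_conv (u : nat -> C) (l : C) : Prop :=
  filterlim (fun N => sum_n u N) eventually (locally l).

Definition cterm (a b : nat -> C) (x0 : R) (n : nat) : C :=
  match n with
  | O => (a O / 2)%C
  | S _ => (a n * RtoC (cos (INR n * x0)%R) + b n * RtoC (sin (INR n * x0)%R))%C
  end.

(* Terms of the formally integrated series L(x). *)
Definition Lterm (a b : nat -> C) (x : R) (n : nat) : C :=
  match n with
  | O => (a O * RtoC (x / 2)%R)%C
  | S _ => (a n / RtoC (INR n) * RtoC (sin (INR n * x)%R)
            - b n / RtoC (INR n) * RtoC (cos (INR n * x)%R))%C
  end.

Definition lebesgue_summable (a b : nat -> C) (x0 : R) (s : C) : Prop :=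
  exists delta : R, 0 < delta /\
  exists L : R -> C,
    (forall x, Rabs (x - x0) < delta -> series_conv (Lterm a b x) (L x)) /\
    filterlim (fun h : R => Cdiv (Cminus (L (x0 + h)) (L (x0 - h))) (RtoC (2 * h)))
      (locally' 0) (locally s).

Definition abel_summable (c : nat -> C) (s : C) : Prop :=
  exists f : R -> C,
    (forall r, 0 < r < 1 -> series_conv (fun n => c n * RtoC (r ^ n)%R)%C (f r)) /\
    filterlim f (at_left 1) (locally s).

(* A_m^beta = binomial(m + beta, m) = prod_{j=1}^m (beta + j) / j. *)
Fixpoint cesA (beta : R) (m : nat) : R :=
  match m with
  | O => 1
  | S k => cesA beta k * ((beta + INR (S k)) / INR (S k))
  end.

Definition cesaro_summable (beta : R) (c : nat -> C) (s : C) : Prop :=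
  filterlim
    (fun n => (sum_n (fun k => RtoC (cesA beta (n - k)) * c k) n
               / RtoC (cesA beta n))%C)
    eventually (locally s).

Definition gamma1 (x : R) : R :=
  if Req_EM_T x 0 then 1 else sin x / x.
Definition gamma2 (x : R) : R :=
  if Req_EM_T x 0 then 1 else (sin (x / 2) / (x / 2)) ^ 2.

Definition riemann_summable (g : R -> R) (c : nat -> C) (s : C) : Prop :=
  exists h0 : R, 0 < h0 /\
  exists f : R -> C,
    (forall h, 0 < h < h0 ->
       series_conv (fun n => c n * RtoC (g (INR n * h)%R))%C (f h)) /\
    filterlim f (at_right 0) (locally s).

Definition rho (a b : nat -> C) (n : nat) : R :=
  sqrt (Cmod (a n) ^ 2 + Cmod (b n) ^ 2).

(* Main.v *)
Require Import Defs.
From Stdlib Require Import Reals Lra Lia.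
From Coquelicot Require Import Coquelicot.
Open Scope R_scope.
Set Bullet Behavior "Strict Subproofs".

(** For real [c] with [sum_(n <= N) n |c_n| <= K N], consider the kernel means
    [sum_n c_n f(n h)] as [h -> 0+]. Abel, Riemann and Riesz summability are the
    cases [f = exp(-x)], [gamma1], [gamma2], [(1 - x)_+^beta]. Summation by parts
    gives [sum_n |c_n| m(n h) <= 2 K] for [m(x) = sqrt x / (1 + sqrt x)^2], so the
    kernels with null means are closed under approximation relative to [m].
    The difference of two of the above kernels is [O(min(x, 1/x))], and Weierstrass
    approximation in the variable [exp(-x)] shows that it has null means as soon as
    all [(exp(-x) - exp(-2x)) exp(-kx)] do. This is Karamata's argument, and it
    leads from Abel to every other mean. From the Riemann means back to Abel the same
    argument uses the variable [(1 + cos(o x))/2] with [o] small: products of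
    [gamma1], [gamma2] with cosines are combinations of their dilates, and the
    aliasing error caused by periodicity is small relative to [m] beyond the first
    half-period.
    Cesaro means differ from Riesz means by [o(1)], and Abel means are averages of
    Cesaro means. Lebesgue summability is termwise the same as the first Riemann
    method. Complex series are treated through real and imaginary parts. *)

(** * Kernel means and their majorant *)

(** The square roots serve localisation. [majorant] has the order [min(sqrt x, 1 / sqrt x)], larger
    than [min(x, 1/x)], and its sums are still bounded. A kernel that is [O(min(x, 1/x))] is
    therefore arbitrarily small relative to [majorant] outside a suitable compact interval [[d, Y]],
    and only approximation on [[d, Y]] remains. On the way back from the Riemann means, dilates of
    the kernel are not closed under multiplication, so no powers of a monotone coordinate are
    available. Multiplication by a cosine is, but a function of a cosine does not decay. The decay
    has to come from the weight [W] in front of it: at a point [x > Y] with the same cosine as some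
    [y] in [[d, Y]], the weighted copy of the kernel [D] has size at most [y |D y| / x], which is
    [O(1/x)]. Each [W] contains a factor vanishing at 0, which cancels the limits of the means and
    brings [W] below a multiple of [majorant]. *)

Lemma sum_n_le_bounded (u v : nat -> R) (N : nat) :
  (forall n, (n <= N)%nat -> u n <= v n) -> sum_n u N <= sum_n v N.
Proof.
  intros H. rewrite !sum_n_Reals. now apply sum_Rle.
Qed.

Lemma sum_n_RS (u : nat -> R) (N : nat) : sum_n u (S N) = sum_n u N + u (S N).
Proof. now rewrite sum_Sn. Qed.

Lemma ex_series_bounded_abs (u : nat -> R) (B : R) :
  (forall N, sum_n (fun n => Rabs (u n)) N <= B) ->
  ex_series (fun n => Rabs (u n)).
Proof.
  intros HB.
  destruct (ex_finite_lim_seq_incr (sum_n (fun n => Rabs (u n))) B) as [l Hl].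
  - intros n. rewrite sum_n_RS. pose proof (Rabs_pos (u (S n))). lra.
  - exact HB.
  - exists l. exact Hl.
Qed.

Lemma Series_abs_bounded (u : nat -> R) (B : R) :
  (forall N, sum_n (fun n => Rabs (u n)) N <= B) -> Rabs (Series u) <= B.
Proof.
  intros HB. pose proof (ex_series_bounded_abs u B HB) as Hex.
  apply Rle_trans with (1 := Series_Rabs u Hex).
  apply Series_correct in Hex.
  apply (is_lim_seq_le (sum_n (fun n => Rabs (u n))) (fun _ => B)
           (Series (fun n => Rabs (u n))) B HB Hex (is_lim_seq_const B)).
Qed.

Lemma ex_series_Rabs_le (u v : nat -> R) :
  (forall n, Rabs (u n) <= v n) -> ex_series v -> ex_series u.
Proof. exact (ex_series_le (V := R_CompleteNormedModule) u v). Qed.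

(** The weight [INR n] leaves [c 0] free; later bounds therefore concern kernels vanishing at 0, or
    split off the index 0. *)
Definition linear_mean (c : nat -> R) (K : R) : Prop :=
  forall N, sum_n (fun n => INR n * Rabs (c n)) N <= K * INR N.

Lemma linear_mean_ge0 (c : nat -> R) (K : R) : linear_mean c K -> 0 <= K.
Proof.
  intros H. specialize (H 1%nat). rewrite sum_n_RS, sum_O in H. simpl in H.
  pose proof (Rabs_pos (c 1%nat)). lra.
Qed.

(** This is [2 x] times the derivative of [sqrt x / (1 + sqrt x)], and for [x > 0] it is invariant
    under replacing [x] by [1 / x]. *)
Definition majorant (x : R) : R := sqrt x / (1 + sqrt x) ^ 2.

Lemma majorant_ge0 (x : R) : 0 <= majorant x.
Proof.
  unfold majorant. pose proof (sqrt_pos x).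
  apply Rdiv_le_0_compat; [assumption | nra].
Qed.

Lemma INR_mult_ge0 (n : nat) (h : R) : 0 < h -> 0 <= INR n * h.
Proof. intros Hh. pose proof (pos_INR n). nra. Qed.

(* Summation by parts against the decreasing weight [majorant x / x], whose
   Riemann sums are dominated by increments of [x |-> sqrt x / (1 + sqrt x)]. *)
Lemma majorant_sum (c : nat -> R) (K h : R) (N : nat) :
  linear_mean c K -> 0 < h ->
  sum_n (fun n => Rabs (c n) * majorant (INR n * h)) N <= 2 * K.
Proof.
  intros Hc Hh.
  pose proof (linear_mean_ge0 c K Hc) as HK.
  set (p := fun n => sqrt (INR n * h)).
  (* For [n > 0], [e n] is [h] times [majorant x / x] at [x = n h], the weight that multiplies
     [n |c n|]. *)
  set (e := fun n => h / (p n * (1 + p n) ^ 2)).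
  set (T := sum_n (fun n => INR n * Rabs (c n))).
  assert (Hp0 : p 0%nat = 0).
  { unfold p. simpl. rewrite Rmult_0_l. apply sqrt_0. }
  assert (Hpp : forall n, p n * p n = INR n * h).
  { intros n. apply sqrt_sqrt. now apply INR_mult_ge0. }
  assert (Hpos : forall n, 0 < p (S n)).
  { intros n. apply sqrt_lt_R0. pose proof (lt_0_INR (S n) ltac:(lia)). nra. }
  assert (Hge : forall n, 0 <= p n) by (intros n; apply sqrt_pos).
  assert (Hmono : forall n, p n <= p (S n)).
  { intros n. apply sqrt_le_1_alt. rewrite S_INR. nra. }
  assert (Hm : forall n, majorant (INR (S n) * h) = INR (S n) * e (S n)).
  { intros n. unfold majorant, e. fold (p (S n)). pose proof (Hpos n).
    field_simplify_eq; [| split; lra]. rewrite <- (Hpp (S n)). ring. }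
  assert (Hdec : forall n, e (S (S n)) <= e (S n)).
  { intros n. unfold e. pose proof (Hpos n). pose proof (Hmono (S n)).
    apply Rmult_le_compat_l; [lra |].
    apply Rinv_le_contravar.
    - apply Rmult_lt_0_compat; [assumption | nra].
    - apply Rmult_le_compat; try lra; nra. }
  assert (He : forall n, e (S n) <= 2 * (p (S n) / (1 + p (S n)) - p n / (1 + p n))).
  { intros n. unfold e. pose proof (Hpos n). pose proof (Hge n). pose proof (Hmono n).
    assert (Hd : h = (p (S n) - p n) * (p (S n) + p n)).
    { replace ((p (S n) - p n) * (p (S n) + p n)) with (p (S n) * p (S n) - p n * p n) by ring.
      rewrite !Hpp, S_INR. ring. }
    rewrite Hd. set (a := p (S n)) in *. set (b := p n) in *.
    replace (2 * (a / (1 + a) - b / (1 + b)))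
      with ((a - b) * (2 / ((1 + a) * (1 + b)))) by (field; lra).
    unfold Rdiv at 1. rewrite Rmult_assoc. apply Rmult_le_compat_l; [lra |].
    apply Rmult_le_reg_r with (a * (1 + a) ^ 2 * (1 + b)).
    - apply Rmult_lt_0_compat; [apply Rmult_lt_0_compat |]; nra.
    - field_simplify; try lra. nra. }
  assert (HTN : forall n, T n <= K * INR n) by exact Hc.
  (* Abel summation as an invariant: the unspent allowance [K n - T n] is carried along with weight
     [e n], which only decreases. *)
  assert (Main : forall n,
    sum_n (fun n => Rabs (c n) * majorant (INR n * h)) n
    + (K * INR n - T n) * e n <= 2 * K * (p n / (1 + p n))).
  { induction n as [|n IH].
    - unfold T. rewrite !sum_O, Hp0. unfold majorant. simpl.
      rewrite Rmult_0_l, sqrt_0. unfold Rdiv. rewrite !Rmult_0_l, !Rmult_0_r. lra.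
    - unfold T. rewrite !sum_n_RS. fold (T n). rewrite Hm.
      pose proof (He n). rewrite S_INR at 2. specialize (HTN n).
      assert ((K * INR n - T n) * e (S n) <= (K * INR n - T n) * e n).
      (* At index 0 the allowance is 0, so the division by zero in [e 0] does no harm. *)
      { destruct n as [|n].
        - replace (T 0%nat) with 0 by (unfold T; rewrite sum_O; simpl; ring).
          simpl. lra.
        - apply Rmult_le_compat_l; [lra | apply Hdec]. }
      nra. }
  specialize (Main N). specialize (HTN N).
  assert (He0 : 0 <= (K * INR N - T N) * e N).
  { destruct N as [|N].
    - replace (T 0%nat) with 0 by (unfold T; rewrite sum_O; simpl; ring). simpl. lra.
    - apply Rmult_le_pos; [lra |]. unfold e. pose proof (Hpos N).
      apply Rdiv_le_0_compat; [lra |]. apply Rmult_lt_0_compat; nra. }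
  assert (p N / (1 + p N) <= 1).
  { pose proof (Hge N). apply Rmult_le_reg_r with (1 + p N); [lra |].
    field_simplify; lra. }
  nra.
Qed.

(** Near 0 [majorant] decays only like [sqrt x], so a linear bound gains the factor [sqrt d]; 4
    bounds [(1 + sqrt x) ^ 2] on [[0, 1]]. *)
Lemma majorant_ge_small (x d : R) : 0 <= x <= d -> d <= 1 -> x <= 4 * sqrt d * majorant x.
Proof.
  intros Hx Hd. unfold majorant.
  pose proof (sqrt_sqrt x ltac:(lra)). pose proof (sqrt_pos x).
  pose proof (sqrt_le_1_alt x d ltac:(lra)).
  assert (sqrt x <= 1) by (rewrite <- sqrt_1; apply sqrt_le_1_alt; lra).
  set (p := sqrt x) in *. set (q := sqrt d) in *.
  apply Rmult_le_reg_r with ((1 + p) ^ 2); [nra |].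
  replace (4 * q * (p / (1 + p) ^ 2) * (1 + p) ^ 2) with (4 * q * p) by (field; lra).
  assert ((1 + p) ^ 2 <= 4) by nra.
  assert (p * p <= p * q) by nra. nra.
Qed.

(** The mirror image at infinity, where [(1 + sqrt x) ^ 2 <= 4 x]. *)
Lemma majorant_ge_large (x Y : R) : 1 <= Y <= x -> / x <= 4 / sqrt Y * majorant x.
Proof.
  intros Hx. unfold majorant.
  pose proof (sqrt_sqrt x ltac:(lra)).
  pose proof (sqrt_le_1_alt Y x ltac:(lra)).
  assert (1 <= sqrt Y) by (rewrite <- sqrt_1; apply sqrt_le_1_alt; lra).
  set (p := sqrt x) in *. set (q := sqrt Y) in *.
  replace (/ x) with (/ (p * p)) by (f_equal; assumption).
  apply Rmult_le_reg_r with (q * (p * p) * (1 + p) ^ 2).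
  { apply Rmult_lt_0_compat; nra. }
  replace (/ (p * p) * (q * (p * p) * (1 + p) ^ 2)) with (q * (1 + p) ^ 2) by (field; lra).
  replace (4 / q * (p / (1 + p) ^ 2) * (q * (p * p) * (1 + p) ^ 2))
    with (p * (4 * (p * p))) by (field; lra).
  apply Rmult_le_compat; nra.
Qed.

Lemma majorant_ge_min (f : R -> R) (C : R) :
  (forall x, 0 <= x -> Rabs (f x) <= C * x) ->
  (forall x, 0 < x -> Rabs (f x) <= C / x) ->
  forall x, 0 <= x -> Rabs (f x) <= 4 * C * majorant x.
Proof.
  intros H0 Hi x Hx. pose proof (majorant_ge0 x).
  assert (HC : 0 <= C).
  { specialize (H0 1 ltac:(lra)). pose proof (Rabs_pos (f 1)). lra. }
  destruct (Rle_dec x 1) as [H1 | H1].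
  - pose proof (majorant_ge_small x 1 ltac:(lra) ltac:(lra)) as Hs.
    rewrite sqrt_1 in Hs. specialize (H0 x Hx). nra.
  - pose proof (majorant_ge_large x 1 ltac:(lra)) as Hs.
    rewrite sqrt_1 in Hs. specialize (Hi x ltac:(lra)). unfold Rdiv in *. nra.
Qed.

Definition kernel_sum (c : nat -> R) (f : R -> R) (h : R) : R :=
  Series (fun n => c n * f (INR n * h)).

(** Convergence is stated separately because [Series] has a value on divergent series too. *)
Definition kernel_lim (c : nat -> R) (f : R -> R) (v : R) : Prop :=
  (forall h, 0 < h -> ex_series (fun n => c n * f (INR n * h))) /\
  (forall eps, 0 < eps -> exists d, 0 < d /\
     forall h, 0 < h < d -> Rabs (kernel_sum c f h - v) < eps).

(** The bound is uniform in [h], which lets approximation relative to [majorant] pass to the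
    limit. *)
Lemma kernel_sum_majorant (c : nat -> R) (K B h : R) (f : R -> R) :
  linear_mean c K -> 0 < h ->
  (forall x, 0 <= x -> Rabs (f x) <= B * majorant x) ->
  ex_series (fun n => c n * f (INR n * h)) /\ Rabs (kernel_sum c f h) <= 2 * K * B.
Proof.
  intros Hc Hh Hf.
  assert (HS : forall N, sum_n (fun n => Rabs (c n * f (INR n * h))) N <= 2 * K * B).
  { intros N. apply Rle_trans with (B * sum_n (fun n => Rabs (c n) * majorant (INR n * h)) N).
    - rewrite <- (sum_n_mult_l (K := R_Ring)). apply sum_n_le_bounded. intros n _.
      rewrite Rabs_mult. specialize (Hf _ (INR_mult_ge0 n h Hh)).
      pose proof (Rabs_pos (c n)). unfold mult; simpl. nra.
    - pose proof (majorant_sum c K h N Hc Hh).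
      assert (0 <= B).
      { specialize (Hf 1 ltac:(lra)). pose proof (Rabs_pos (f 1)).
        unfold majorant in Hf. rewrite sqrt_1 in Hf. lra. }
      nra. }
  split.
  - apply ex_series_Rabs. exact (ex_series_bounded_abs _ _ HS).
  - exact (Series_abs_bounded _ _ HS).
Qed.

(** Index 0 is split off, so kernels with [f 0 = 1], and even [Rinv], are covered. The comparison
    series is the majorant sum at scale 1, since [majorant] dominates a multiple of [1/x] at the
    points [INR n >= 1]. *)
Lemma kernel_ex_series (c : nat -> R) (K B : R) (f : R -> R) :
  linear_mean c K -> (forall x, 0 < x -> Rabs (f x) <= B / x) ->
  forall h, 0 < h -> ex_series (fun n => c n * f (INR n * h)).
Proof.
  intros Hc Hf h Hh. apply ex_series_incr_1.
  assert (HB : 0 <= B).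
  { specialize (Hf 1 ltac:(lra)). pose proof (Rabs_pos (f 1)). lra. }
  apply ex_series_Rabs_le with
    (fun n => 4 * B / h * (Rabs (c (S n) * majorant (INR (S n) * 1)))).
  - intros n. rewrite !Rabs_mult.
    assert (H1 : 1 <= INR (S n)).
    { rewrite S_INR. pose proof (pos_INR n). lra. }
    rewrite (Rabs_right (majorant _)) by (apply Rle_ge, majorant_ge0).
    pose proof (majorant_ge_large (INR (S n)) 1 ltac:(lra)) as Hm.
    rewrite sqrt_1 in Hm. rewrite Rmult_1_r.
    specialize (Hf (INR (S n) * h) ltac:(nra)).
    assert (B / (INR (S n) * h) <= 4 * B / h * majorant (INR (S n))).
    { replace (B / (INR (S n) * h)) with (B / h * / INR (S n)) by (field; lra).
      replace (4 * B / h * majorant (INR (S n)))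
        with (B / h * (4 / 1 * majorant (INR (S n)))) by (field; lra).
      apply Rmult_le_compat_l; [apply Rdiv_le_0_compat; lra | assumption]. }
    pose proof (Rabs_pos (c (S n))). nra.
  - apply (ex_series_scal (V := R_NormedModule) (4 * B / h)
             (fun n => Rabs (c (S n) * majorant (INR (S n) * 1)))).
    apply (ex_series_incr_1 (fun n => Rabs (c n * majorant (INR n * 1)))).
    apply ex_series_bounded_abs with (2 * K). intros N.
    apply Rle_trans with (2 := majorant_sum c K 1 N Hc Rlt_0_1).
    apply sum_n_le_bounded. intros n _. rewrite Rabs_mult.
    rewrite (Rabs_right (majorant _)) by (apply Rle_ge, majorant_ge0). lra.
Qed.

Lemma kernel_lim_plus (c : nat -> R) (f g : R -> R) (u v : R) :
  kernel_lim c f u -> kernel_lim c g v -> kernel_lim c (fun x => f x + g x) (u + v).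
Proof.
  intros [Ef Lf] [Eg Lg]. split.
  - intros h Hh. apply (ex_series_ext (fun n => plus (c n * f (INR n * h)) (c n * g (INR n * h)))).
    + intros n. unfold plus; simpl. ring.
    + apply (ex_series_plus (V := R_NormedModule)); auto.
  - intros eps He. destruct (Lf (eps / 2) ltac:(lra)) as [d1 [Hd1 H1]].
    destruct (Lg (eps / 2) ltac:(lra)) as [d2 [Hd2 H2]].
    exists (Rmin d1 d2). split; [now apply Rmin_pos |].
    intros h Hh. pose proof (Rmin_l d1 d2). pose proof (Rmin_r d1 d2).
    specialize (H1 h ltac:(lra)). specialize (H2 h ltac:(lra)).
    replace (kernel_sum c (fun x => f x + g x) h) with (kernel_sum c f h + kernel_sum c g h).
    + apply Rabs_def2 in H1. apply Rabs_def2 in H2. apply Rabs_def1; lra.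
    + unfold kernel_sum. rewrite <- Series_plus by (auto; apply Ef || apply Eg; lra).
      apply Series_ext. intros n. ring.
Qed.

Lemma kernel_lim_scal (c : nat -> R) (f : R -> R) (k u : R) :
  kernel_lim c f u -> kernel_lim c (fun x => k * f x) (k * u).
Proof.
  intros [Ef Lf]. split.
  - intros h Hh. apply (ex_series_ext (fun n => scal k (c n * f (INR n * h)))).
    + intros n. unfold scal; simpl. unfold mult; simpl. ring.
    + apply (ex_series_scal (V := R_NormedModule)); auto.
  - intros eps He. pose proof (Rabs_pos k).
    destruct (Lf (eps / (Rabs k + 1))) as [d [Hd H1]].
    { apply Rdiv_lt_0_compat; lra. }
    exists d. split; [assumption |]. intros h Hh. specialize (H1 h Hh).
    replace (kernel_sum c (fun x => k * f x) h) with (k * kernel_sum c f h).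
    + rewrite <- Rmult_minus_distr_l, Rabs_mult.
      apply Rmult_lt_compat_r with (r := Rabs k + 1) in H1; [| lra].
      replace (eps / (Rabs k + 1) * (Rabs k + 1)) with eps in H1 by (field; lra).
      pose proof (Rabs_pos (kernel_sum c f h - u)). nra.
    + unfold kernel_sum. rewrite <- Series_scal_l. apply Series_ext. intros n. ring.
Qed.

Lemma kernel_lim_ext (c : nat -> R) (f g : R -> R) (v : R) :
  (forall x, 0 <= x -> f x = g x) -> kernel_lim c f v -> kernel_lim c g v.
Proof.
  intros Hfg [Ef Lf]. split.
  - intros h Hh. apply (ex_series_ext (fun n => c n * f (INR n * h))); [| auto].
    intros n. rewrite Hfg; [reflexivity | now apply INR_mult_ge0].
  - intros eps He. destruct (Lf eps He) as [d [Hd H1]]. exists d. split; [assumption |].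
    intros h Hh. unfold kernel_sum. rewrite <- (Series_ext (fun n => c n * f (INR n * h))); [now apply H1 |].
    intros n. rewrite Hfg; [reflexivity | now apply INR_mult_ge0].
Qed.

Lemma kernel_lim_dilate (c : nat -> R) (f : R -> R) (k v : R) :
  0 < k -> kernel_lim c f v -> kernel_lim c (fun x => f (k * x)) v.
Proof.
  intros Hk [Ef Lf]. split.
  - intros h Hh. apply (ex_series_ext (fun n => c n * f (INR n * (k * h)))).
    + intros n. do 2 f_equal. ring.
    + apply Ef. nra.
  - intros eps He. destruct (Lf eps He) as [d [Hd H1]]. exists (d / k).
    split; [apply Rdiv_lt_0_compat; lra |]. intros h Hh.
    replace (kernel_sum c (fun x => f (k * x)) h) with (kernel_sum c f (k * h)).
    + apply H1. split; [nra |]. replace d with (k * (d / k)) by (field; lra).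
      apply Rmult_lt_compat_l; lra.
    + apply Series_ext. intros n. do 2 f_equal. ring.
Qed.

Lemma kernel_lim_0 (c : nat -> R) : kernel_lim c (fun _ => 0) 0.
Proof.
  split.
  - intros h Hh. apply ex_series_Rabs_le with (fun n => (/ 2) ^ n).
    + intros n. rewrite Rmult_0_r, Rabs_R0. apply pow_le. lra.
    + apply ex_series_geom. rewrite Rabs_right; lra.
  - intros eps He. exists 1. split; [lra |]. intros h Hh.
    unfold kernel_sum. rewrite Series_scal_r. rewrite Rmult_0_r, Rminus_0_r, Rabs_R0.
    assumption.
Qed.

(** An error [eta * majorant] changes every mean by at most [2 K eta], whatever [h] is;
    [eta = eps / (4 K + 2)] keeps this below [eps / 2]. *)
Lemma kernel_lim_closed (c : nat -> R) (K : R) (f : R -> R) :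
  linear_mean c K ->
  (forall eta, 0 < eta -> exists g, kernel_lim c g 0 /\
     forall x, 0 <= x -> Rabs (f x - g x) <= eta * majorant x) ->
  kernel_lim c f 0.
Proof.
  intros Hc Hg. pose proof (linear_mean_ge0 c K Hc) as HK.
  assert (Split : forall g h, 0 < h ->
    ex_series (fun n => c n * g (INR n * h)) ->
    ex_series (fun n => c n * (fun x => f x - g x) (INR n * h)) ->
    ex_series (fun n => c n * f (INR n * h)) /\
    kernel_sum c f h = kernel_sum c g h + kernel_sum c (fun x => f x - g x) h).
  { intros g h Hh E1 E2. split.
    - apply (ex_series_ext (fun n => plus (c n * g (INR n * h)) (c n * (f (INR n * h) - g (INR n * h))))).
      + intros n. unfold plus; simpl. ring.
      + apply (ex_series_plus (V := R_NormedModule)); auto.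
    - unfold kernel_sum. rewrite <- Series_plus by auto.
      apply Series_ext. intros n. ring. }
  split.
  - intros h Hh. destruct (Hg 1 Rlt_0_1) as [g [[Eg _] Hfg]].
    apply (Split g h Hh (Eg h Hh)).
    now apply (kernel_sum_majorant c K 1 h (fun x => f x - g x)).
  - intros eps He.
    assert (Heta : 0 < eps / (4 * K + 2)) by (apply Rdiv_lt_0_compat; lra).
    destruct (Hg _ Heta) as [g [[Eg Lg] Hfg]].
    destruct (Lg (eps / 2) ltac:(lra)) as [d [Hd H1]].
    exists d. split; [assumption |]. intros h Hh. specialize (H1 h Hh).
    destruct (kernel_sum_majorant c K _ h (fun x => f x - g x) Hc ltac:(lra) Hfg) as [E2 B2].
    destruct (Split g h ltac:(lra) (Eg h ltac:(lra)) E2) as [_ ->].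
    assert (2 * K * (eps / (4 * K + 2)) < eps / 2).
    { apply Rmult_lt_reg_r with (4 * K + 2); [lra |]. field_simplify; [| lra]. nra. }
    rewrite Rminus_0_r in *.
    apply Rle_lt_trans with (1 := Rabs_triang _ _). lra.
Qed.

(** * Weierstrass approximation of kernels *)

(* The Bernstein polynomial as an expectation over [n] Bernoulli trials,
   computed by conditioning on one trial. *)
Fixpoint bernstein (n : nat) (f : nat -> R) (t : R) : R :=
  match n with
  | O => f O
  | S k => (1 - t) * bernstein k f t + t * bernstein k (fun j => f (S j)) t
  end.

Lemma bernstein_le (n : nat) (f g : nat -> R) (t : R) :
  0 <= t <= 1 -> (forall k, (k <= n)%nat -> f k <= g k) ->
  bernstein n f t <= bernstein n g t.
Proof.
  intros Ht. revert f g. induction n as [|n IH]; intros f g H; simpl.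
  - apply H. lia.
  - specialize (IH f g) as I1. specialize (IH (fun j => f (S j)) (fun j => g (S j))) as I2.
    assert (bernstein n f t <= bernstein n g t) by (apply I1; intros; apply H; lia).
    assert (bernstein n (fun j => f (S j)) t <= bernstein n (fun j => g (S j)) t)
      by (apply I2; intros; apply H; lia).
    nra.
Qed.

Lemma bernstein_affine (n : nat) (f : nat -> R) (a b t : R) :
  bernstein n (fun k => a + b * f k) t = a + b * bernstein n f t.
Proof.
  revert f. induction n as [|n IH]; intros f; simpl; [reflexivity |].
  rewrite IH, (IH (fun j => f (S j))). ring.
Qed.

(** The centre [a] is free because a successful first trial shifts it to [a - 1]; [a = n t] gives
    the binomial variance. *)
Lemma bernstein_variance (n : nat) (a t : R) :
  bernstein n (fun k => (INR k - a) ^ 2) t = INR n * t * (1 - t) + (INR n * t - a) ^ 2.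
Proof.
  assert (E : forall n f g, (forall k, f k = g k) -> bernstein n f t = bernstein n g t).
  { clear. induction n as [|n IH]; intros f g H; simpl; [apply H |].
    now rewrite (IH f g H), (IH (fun j => f (S j)) (fun j => g (S j)) (fun k => H (S k))). }
  revert a. induction n as [|n IH]; intros a; [simpl; ring |].
  cbn [bernstein]. rewrite IH, (E n _ (fun k => (INR k - (a - 1)) ^ 2)).
  - rewrite IH, S_INR. ring.
  - intros k. rewrite S_INR. ring.
Qed.

(** Uniform continuity and boundedness give [w] the quadratic modulus [eps / 2 + q (y - x) ^ 2]. Its
    expectation involves only the variance [n t (1 - t)], so the error is at most
    [eps / 2 + q / n]. *)
Lemma bernstein_approx (w : R -> R) (eps : R) :
  (forall t, 0 <= t <= 1 -> continuity_pt w t) -> 0 < eps ->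
  exists (n : nat) (f : nat -> R),
    forall t, 0 <= t <= 1 -> Rabs (w t - bernstein n f t) <= eps.
Proof.
  intros Hw He.
  destruct (Heine_cor2 Hw (mkposreal (eps / 2) ltac:(lra))) as [[d Hd] Hu]. simpl in Hu.
  assert (HB : exists B, 0 <= B /\ forall t, 0 <= t <= 1 -> Rabs (w t) <= B).
  { destruct (continuity_ab_maj (fun t => Rabs (w t)) 0 1 ltac:(lra)) as [M [HM _]].
    - intros t Ht. apply (continuity_pt_comp w Rabs); [now apply Hw | apply Rcontinuity_abs].
    - exists (Rabs (w M)). split; [apply Rabs_pos | exact HM]. }
  destruct HB as [B [HB0 HB]].
  (* Chosen so that at distance [d] the quadratic term reaches [2 B], a bound for any difference of
     values of [w]. *)
  set (q := 2 * B / d ^ 2).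
  assert (Hd2 : 0 < d ^ 2) by (apply pow_lt; assumption).
  assert (Hq : 0 <= q) by (apply Rdiv_le_0_compat; lra).
  assert (Hmod : forall x y, 0 <= x <= 1 -> 0 <= y <= 1 ->
    Rabs (w x - w y) <= eps / 2 + q * (y - x) ^ 2).
  { intros x y Hx Hy. destruct (Rlt_dec (Rabs (x - y)) d) as [H | H].
    - specialize (Hu x y Hx Hy H). pose proof (pow2_ge_0 (y - x)). nra.
    - apply Rnot_lt_le in H.
      assert (d ^ 2 <= (y - x) ^ 2).
      { replace ((y - x) ^ 2) with (Rabs (x - y) ^ 2) by (rewrite pow2_abs; ring).
        apply pow_incr. lra. }
      assert (2 * B <= q * (y - x) ^ 2).
      { replace (2 * B) with (q * d ^ 2) by (unfold q; field; lra).
        apply Rmult_le_compat_l; assumption. }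
      pose proof (HB x Hx). pose proof (HB y Hy).
      pose proof (Rabs_triang (w x) (- w y)) as Ht. rewrite Rabs_Ropp in Ht.
      unfold Rminus. lra. }
  destruct (INR_unbounded (2 * q / eps)) as [N HN].
  set (n := S N).
  assert (Hn : 2 * q / eps < INR n) by (unfold n; rewrite S_INR; lra).
  assert (Hn0 : 0 < INR n) by (apply lt_0_INR; unfold n; lia).
  exists n, (fun k => w (INR k / INR n)). intros t Ht.
  assert (Hk : forall k, (k <= n)%nat -> 0 <= INR k / INR n <= 1).
  { intros k Hk. apply le_INR in Hk. pose proof (pos_INR k). split.
    - apply Rdiv_le_0_compat; lra.
    - apply Rmult_le_reg_r with (INR n); [lra |]. field_simplify; lra. }
  set (V := fun k => (INR k - INR n * t) ^ 2).
  assert (HV : bernstein n V t = INR n * t * (1 - t)).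
  { unfold V. rewrite bernstein_variance. ring. }
  assert (Hpt : forall k, (k <= n)%nat ->
    Rabs (w t - w (INR k / INR n)) <= eps / 2 + q / INR n ^ 2 * V k).
  { intros k Hkn. apply Rle_trans with (1 := Hmod t _ Ht (Hk k Hkn)).
    right. unfold V. field. lra. }
  assert (Hfin : q / INR n ^ 2 * bernstein n V t <= eps / 2).
  { rewrite HV.
    replace (q / INR n ^ 2 * (INR n * t * (1 - t))) with (q / INR n * (t * (1 - t)))
      by (field; lra).
    assert (q / INR n <= eps / 2).
    { apply Rmult_le_reg_r with (INR n); [lra |].
      replace (q / INR n * INR n) with q by (field; lra).
      apply Rmult_lt_compat_r with (r := eps) in Hn; [| lra].
      replace (2 * q / eps * eps) with (2 * q) in Hn by (field; lra). lra. }
    assert (0 <= q / INR n) by (apply Rdiv_le_0_compat; lra).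
    assert (0 <= t * (1 - t) <= 1) by nra. nra. }
  pose proof (bernstein_affine n V (w t + eps / 2) (q / INR n ^ 2) t) as A1.
  pose proof (bernstein_affine n V (w t - eps / 2) (- (q / INR n ^ 2)) t) as A2.
  apply Rabs_le. split.
  - enough (bernstein n (fun k => w (INR k / INR n)) t
            <= bernstein n (fun k => w t + eps / 2 + q / INR n ^ 2 * V k) t) by lra.
    apply bernstein_le; [assumption |]. intros k Hkn.
    specialize (Hpt k Hkn). apply Rabs_le_between in Hpt. lra.
  - enough (bernstein n (fun k => w t - eps / 2 + - (q / INR n ^ 2) * V k) t
            <= bernstein n (fun k => w (INR k / INR n)) t) by lra.
    apply bernstein_le; [assumption |]. intros k Hkn.
    specialize (Hpt k Hkn). apply Rabs_le_between in Hpt. lra.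
Qed.

Lemma kernel_lim_bernstein (c : nat -> R) (W T : R -> R) (n : nat) (f : nat -> R) :
  (forall k, kernel_lim c (fun x => W x * T x ^ k) 0) ->
  kernel_lim c (fun x => W x * bernstein n f (T x)) 0.
Proof.
  intros HWT.
  (* The induction needs the extra power, because each Bernstein step multiplies by [T] or
     [1 - T]. *)
  enough (H : forall k, kernel_lim c (fun x => W x * T x ^ k * bernstein n f (T x)) 0).
  { apply kernel_lim_ext with (2 := H 0%nat). intros x _. simpl. ring. }
  revert f. induction n as [|n IH]; intros f k; simpl.
  - replace 0 with (f 0%nat * 0) by ring.
    apply kernel_lim_ext with (2 := kernel_lim_scal c _ (f 0%nat) 0 (HWT k)).
    intros x _. ring.
  - replace 0 with (0 + (-1 * 0 + 0)) by ring.
    apply kernel_lim_ext with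
      (2 := kernel_lim_plus c _ _ _ _ (IH f k)
              (kernel_lim_plus c _ _ _ _ (kernel_lim_scal c _ (-1) 0 (IH f (S k)))
                 (IH (fun j => f (S j)) (S k)))).
    intros x _. simpl. ring.
Qed.

(** The factor [W], at most [B * majorant], turns uniform approximation of [w] into approximation
    relative to [majorant]. *)
Lemma kernel_lim_weierstrass (c : nat -> R) (K B : R) (W T w : R -> R) :
  linear_mean c K ->
  (forall x, 0 <= x -> 0 <= T x <= 1) ->
  (forall x, 0 <= x -> Rabs (W x) <= B * majorant x) ->
  (forall k, kernel_lim c (fun x => W x * T x ^ k) 0) ->
  (forall t, 0 <= t <= 1 -> continuity_pt w t) ->
  kernel_lim c (fun x => W x * w (T x)) 0.
Proof.
  intros Hc HT HW HWT Hw. apply (kernel_lim_closed c K); [assumption |].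
  intros eta Heta.
  assert (HB : 0 <= B).
  { specialize (HW 1 ltac:(lra)). pose proof (Rabs_pos (W 1)).
    unfold majorant in HW. rewrite sqrt_1 in HW. lra. }
  assert (He : 0 < eta / (B + 1)) by (apply Rdiv_lt_0_compat; lra).
  destruct (bernstein_approx w _ Hw He) as [n [f Hf]].
  exists (fun x => W x * bernstein n f (T x)). split.
  - now apply kernel_lim_bernstein.
  - intros x Hx. specialize (Hf _ (HT x Hx)). specialize (HW x Hx).
    rewrite <- Rmult_minus_distr_l, Rabs_mult.
    apply Rle_trans with (B * majorant x * (eta / (B + 1))).
    + apply Rmult_le_compat; auto using Rabs_pos.
    + replace (B * majorant x * (eta / (B + 1)))
        with (eta * majorant x * (B / (B + 1))) by (field; lra).
      assert (B / (B + 1) <= 1)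
        by (apply Rmult_le_reg_r with (B + 1); [lra | field_simplify; lra]).
      pose proof (majorant_ge0 x). assert (0 <= eta * majorant x) by nra. nra.
Qed.

(** * Cutoffs and localisation to a compact interval *)

Lemma clamp_continuous (a b : R) : continuity (fun x => Rmax a (Rmin b x)).
Proof.
  intros x. apply continuity_pt_locally. intros eps. exists eps. intros y Hy.
  unfold ball in Hy; simpl in Hy; unfold AbsRing_ball, abs, minus, plus, opp in Hy; simpl in Hy.
  apply Rle_lt_trans with (2 := Hy).
  unfold Rmax, Rmin, Rabs.
  repeat (destruct Rle_dec || destruct Rcase_abs); lra.
Qed.

(** A product of two linear ramps. It vanishes at both ends of [[d, Y]], where a clamped inverse [S]
    saturates and no longer inverts [T]. *)
Lemma cutoff_exists (d Y : R) : 0 < d -> 0 < Y ->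
  exists chi : R -> R, continuity chi /\ (forall x, 0 <= chi x <= 1) /\
    (forall x, x <= d -> chi x = 0) /\ (forall x, Y <= x -> chi x = 0) /\
    (forall x, 2 * d <= x <= Y / 2 -> chi x = 1).
Proof.
  intros Hd HY.
  set (k := fun x => Rmax 0 (Rmin 1 x)).
  assert (Hk : continuity k) by apply clamp_continuous.
  assert (Hkb : forall x, 0 <= k x <= 1).
  { intros x. unfold k, Rmax, Rmin. repeat destruct Rle_dec; lra. }
  assert (Hk0 : forall x, x <= 0 -> k x = 0).
  { intros x Hx. unfold k, Rmax, Rmin. repeat destruct Rle_dec; lra. }
  assert (Hk1 : forall x, 1 <= x -> k x = 1).
  { intros x Hx. unfold k, Rmax, Rmin. repeat destruct Rle_dec; lra. }
  exists (fun x => k ((x - d) * / d) * k ((Y - x) * (2 / Y))).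
  assert (Hd' : 0 < / d) by now apply Rinv_0_lt_compat.
  assert (HY' : 0 < 2 / Y) by (apply Rdiv_lt_0_compat; lra).
  split; [| split; [| split; [| split]]].
  - intros x. apply (continuity_pt_mult (fun x => k ((x - d) * / d)) (fun x => k ((Y - x) * (2 / Y)))).
    + apply (continuity_pt_comp (fun x => (x - d) * / d) k); [reg | apply Hk].
    + apply (continuity_pt_comp (fun x => (Y - x) * (2 / Y)) k); [reg | apply Hk].
  - intros x. pose proof (Hkb ((x - d) * / d)). pose proof (Hkb ((Y - x) * (2 / Y))). nra.
  - intros x Hx. rewrite Hk0; [ring | nra].
  - intros x Hx. rewrite (Hk0 ((Y - x) * _)); [ring | nra].
  - intros x Hx. rewrite !Hk1; [ring | |].
    + apply Rmult_le_reg_r with Y; [assumption |].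
      replace ((Y - x) * (2 / Y) * Y) with (2 * (Y - x)) by (field; lra). lra.
    + apply Rmult_le_reg_r with d; [assumption |].
      replace ((x - d) * / d * d) with (x - d) by (field; lra). lra.
Qed.

(* [T] is a coordinate on [[d, Y]] with inverse [S], and [W], [W * T], [W * T^2], ...
   are null kernels. When [T] is not injective on the half-line, [x |-> S (T x)]
   folds it back to [[d, Y]], and the last condition controls the aliasing error. *)
Definition null_frame (c : nat -> R) (d Y : R) (T S W : R -> R) : Prop :=
  (forall x, 0 <= x -> 0 <= T x <= 1) /\
  (exists B, forall x, 0 <= x -> Rabs (W x) <= B * majorant x) /\
  (forall k, kernel_lim c (fun x => W x * T x ^ k) 0) /\
  (forall t, 0 <= t <= 1 -> continuity_pt S t /\ d <= S t <= Y) /\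
  (forall x, d <= x <= Y -> continuity_pt W x /\ W x <> 0 /\ S (T x) = x) /\
  (forall x, 0 <= x -> d < S (T x) < Y ->
     S (T x) <= x /\ Rabs (x * W x) <= Rabs (S (T x) * W (S (T x)))).

(** The approximant is [W * w(T)], where [w] is [D * chi / W] read in the coordinate [T]. It equals
    [D * chi] on [[d, Y]], vanishes below [d], and is at most [C / x] above [Y]. *)
Lemma kernel_lim_of_frames (c : nat -> R) (K C : R) (D : R -> R) :
  linear_mean c K ->
  (forall d Y, 0 < d -> d < Y -> exists T S W, null_frame c d Y T S W) ->
  (forall x, 0 < x -> continuity_pt D x) ->
  (forall x, 0 <= x -> Rabs (D x) <= C * x) ->
  (forall x, 0 < x -> Rabs (D x) <= C / x) ->
  kernel_lim c D 0.
Proof.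
  intros Hc Hframe HD HD0 HDi. apply (kernel_lim_closed c K); [assumption |].
  intros eta Heta.
  assert (HC : 0 <= C).
  { specialize (HD0 1 ltac:(lra)). pose proof (Rabs_pos (D 1)). lra. }
  (* With [2 d = e ^ 2] and [Y / 2 = 1 / e ^ 2], the gains [sqrt (2 d)] and [1 / sqrt (Y / 2)] both
     equal [e]. The 8 is the 4 of the majorant estimates, doubled for the two terms beyond [Y]: [D]
     and its alias. *)
  set (e := Rmin 1 (eta / (8 * C + 1))).
  assert (He : 0 < e <= 1).
  { unfold e. split; [apply Rmin_pos; [lra | apply Rdiv_lt_0_compat; lra] | apply Rmin_l]. }
  assert (HCe : 8 * C * e <= eta).
  { apply Rle_trans with ((8 * C + 1) * (eta / (8 * C + 1))); [| right; field; lra].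
    apply Rmult_le_compat; try lra. apply Rmin_r. }
  set (d := e ^ 2 / 2). set (Y := 2 / e ^ 2).
  assert (He2 : 0 < e ^ 2 <= 1) by nra.
  assert (Hd : 0 < d) by (unfold d; lra).
  assert (HY : 2 <= Y).
  { unfold Y. apply Rmult_le_reg_r with (e ^ 2); [lra |]. field_simplify; lra. }
  assert (Hsm : forall x, 0 <= x <= 2 * d -> Rabs (D x) <= eta * majorant x).
  { intros x Hx. pose proof (HD0 x ltac:(lra)).
    pose proof (majorant_ge_small x (e ^ 2) ltac:(unfold d in Hx; lra) ltac:(lra)) as Hm.
    replace (sqrt (e ^ 2)) with e in Hm by (rewrite sqrt_pow2; lra).
    pose proof (majorant_ge0 x).
    apply Rle_trans with (8 * C * e * majorant x); [nra |].
    now apply Rmult_le_compat_r. }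
  assert (Hlg : forall x, Y / 2 <= x -> 2 * (C / x) <= eta * majorant x).
  { intros x Hx.
    assert (HYe : Y / 2 = (/ e) ^ 2) by (unfold Y; field; lra).
    pose proof (majorant_ge_large x (Y / 2) ltac:(lra)) as Hm.
    assert (0 < / e) by (apply Rinv_0_lt_compat; lra).
    rewrite HYe, sqrt_pow2 in Hm by lra.
    replace (4 / / e) with (4 * e) in Hm by (field; lra).
    pose proof (majorant_ge0 x).
    apply Rle_trans with (8 * C * e * majorant x); [unfold Rdiv; nra |].
    now apply Rmult_le_compat_r. }
  destruct (Hframe d Y Hd ltac:(unfold d; lra)) as
    [T [S [W [HT [[B HB] [HWT [HS [HW Hfold]]]]]]]].
  destruct (cutoff_exists d Y Hd ltac:(lra)) as [chi [Xc [Xb [X0 [XY X1]]]]].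
  set (w := fun t => D (S t) * chi (S t) / W (S t)).
  exists (fun x => W x * w (T x)). split.
  - apply (kernel_lim_weierstrass c K B); try assumption.
    intros t Ht. destruct (HS t Ht) as [HSc HSb]. destruct (HW _ HSb) as [HWc [HW0 _]].
    apply (continuity_pt_comp S (fun y => D y * chi y / W y)); [assumption |].
    apply (continuity_pt_div (fun y => D y * chi y) W); try assumption.
    apply (continuity_pt_mult D chi); [apply HD; lra | apply Xc].
  - intros x Hx. unfold w.
    assert (Hcut : Rabs (D x - D x * chi x) <= eta * majorant x).
    { replace (D x - D x * chi x) with (D x * (1 - chi x)) by ring.
      rewrite Rabs_mult. pose proof (Xb x). pose proof (Rabs_pos (D x)).
      rewrite (Rabs_right (1 - chi x)) by lra.
      destruct (Rle_dec x (2 * d)) as [Hxd | Hxd].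
      - specialize (Hsm x ltac:(lra)). nra.
      - destruct (Rle_dec (Y / 2) x) as [HxY | HxY].
        + specialize (Hlg x ltac:(lra)). specialize (HDi x ltac:(lra)).
          assert (0 <= C / x) by (apply Rdiv_le_0_compat; lra). nra.
        + rewrite X1 by lra. pose proof (majorant_ge0 x). nra. }
    destruct (Rle_dec d x) as [Hdx | Hdx]; [destruct (Rle_dec x Y) as [HxY | HxY] |].
    + destruct (HW x ltac:(lra)) as [_ [HW0 ->]].
      replace (W x * (D x * chi x / W x)) with (D x * chi x) by (field; assumption).
      exact Hcut.
    + apply Rle_trans with (2 := Hlg x ltac:(lra)).
      pose proof (HDi x ltac:(lra)) as HDx.
      assert (HCx : 0 <= C / x) by (apply Rdiv_le_0_compat; lra).
      set (y := S (T x)) in *.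
      enough (Rabs (W x * (D y * chi y / W y)) <= C / x).
      { pose proof (Rabs_triang (D x) (- (W x * (D y * chi y / W y)))) as Ht.
        rewrite Rabs_Ropp in Ht. unfold Rminus. lra. }
      destruct (HS (T x) (HT x Hx)) as [_ HSb]. fold y in HSb.
      destruct (HW y HSb) as [_ [HW0 _]].
      destruct (Req_dec (chi y) 0) as [Hy0 | Hy0].
      { rewrite Hy0. unfold Rdiv at 1. rewrite Rmult_0_r, Rmult_0_l, Rmult_0_r, Rabs_R0.
        assumption. }
      assert (Hy : d < y < Y).
      { split; apply Rnot_le_lt; intros H; apply Hy0; auto. }
      destruct (Hfold x Hx Hy) as [_ Hxy]. fold y in Hxy.
      (* The ratio of [x W x] to [y W y] is at most 1 in absolute value by the fold condition,
         [y D y] is at most [C], and [chi y / x] is at most [1 / x]. *)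
      replace (W x * (D y * chi y / W y)) with
        (x * W x * / (y * W y) * (y * D y) * (chi y * / x)) by (field; lra).
      rewrite !Rabs_mult, Rabs_inv.
      rewrite Rabs_mult in Hxy.
      assert (HyW : 0 < Rabs (y * W y)).
      { apply Rabs_pos_lt. apply Rmult_integral_contrapositive. split; [lra | assumption]. }
      assert (H1 : Rabs x * Rabs (W x) * / Rabs (y * W y) <= 1).
      { apply Rmult_le_reg_r with (Rabs (y * W y)); [assumption |].
        rewrite Rmult_assoc, Rinv_l by lra. lra. }
      assert (H2 : Rabs y * Rabs (D y) <= C).
      { rewrite (Rabs_right y) by lra. specialize (HDi y ltac:(lra)).
        apply Rmult_le_compat_l with (r := y) in HDi; [| lra].
        replace (y * (C / y)) with C in HDi by (field; lra). assumption. }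
      assert (H3 : Rabs (chi y) * Rabs (/ x) <= / x).
      { pose proof (Xb y). rewrite Rabs_right by lra.
        assert (0 < / x) by (apply Rinv_0_lt_compat; lra).
        rewrite Rabs_right by lra. nra. }
      replace (C / x) with (1 * C * / x) by (field; lra).
      apply Rmult_le_compat; [| apply Rmult_le_pos; apply Rabs_pos | | assumption].
      * repeat apply Rmult_le_pos; try apply Rabs_pos. left; now apply Rinv_0_lt_compat.
      * apply Rmult_le_compat; try assumption.
        -- repeat apply Rmult_le_pos; try apply Rabs_pos. left; now apply Rinv_0_lt_compat.
        -- apply Rmult_le_pos; apply Rabs_pos.
    (* For [x < d], a value [S (T x)] strictly between [d] and [Y] would be at most [x] by the fold
       condition. So it is an endpoint, where [chi] vanishes. *)
    + replace (chi (S (T x))) with 0.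
      * rewrite Rmult_0_r, Rdiv_0_l, Rmult_0_r, Rminus_0_r. apply Hsm. lra.
      * symmetry. destruct (Rle_dec (S (T x)) d) as [H | H]; [auto |].
        destruct (Rle_dec Y (S (T x))) as [H' | H']; [auto |].
        destruct (Hfold x Hx ltac:(lra)). lra.
Qed.

(** * The exponential kernel and the Riemann kernels *)

Lemma exp_le_compat (x y : R) : x <= y -> exp x <= exp y.
Proof. intros [H | ->]; [left; now apply exp_increasing | lra]. Qed.

Lemma exp_pow_nat (n : nat) (x : R) : exp x ^ n = exp (INR n * x).
Proof.
  induction n as [|n IH].
  - simpl. now rewrite Rmult_0_l, exp_0.
  - rewrite <- tech_pow_Rmult, IH, <- exp_plus, S_INR. f_equal. ring.
Qed.

(** The first condition forces [f 0 = 1], so the uncontrolled [c 0] drops out of the difference of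
    two such kernels, and that difference is [O(min(x, 1/x))]. *)
Definition admissible (f : R -> R) (C : R) : Prop :=
  (forall x, 0 <= x -> Rabs (f x - 1) <= C * x) /\
  (forall x, 0 < x -> Rabs (f x) <= C / x) /\
  (forall x, 0 < x -> continuity_pt f x).

Lemma kernel_lim_transfer (c : nat -> R) (K C1 C2 s : R) (f g : R -> R) :
  linear_mean c K -> admissible f C1 -> admissible g C2 ->
  (forall d Y, 0 < d -> d < Y -> exists T S W, null_frame c d Y T S W) ->
  kernel_lim c f s -> kernel_lim c g s.
Proof.
  intros Hc [f0 [fi fc]] [g0 [gi gc]] Hframe Hf.
  assert (HD : kernel_lim c (fun x => g x - f x) 0).
  { apply (kernel_lim_of_frames c K (C1 + C2)); try assumption.
    - intros x Hx. apply (continuity_pt_minus g f); auto.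
    - intros x Hx. specialize (f0 x Hx). specialize (g0 x Hx).
      apply Rabs_le_between in f0. apply Rabs_le_between in g0. apply Rabs_le. lra.
    - intros x Hx. specialize (fi x Hx). specialize (gi x Hx).
      apply Rabs_le_between in fi. apply Rabs_le_between in gi. apply Rabs_le.
      unfold Rdiv in *. lra. }
  replace s with (s + 0) by ring.
  apply kernel_lim_ext with (2 := kernel_lim_plus c _ _ _ _ Hf HD). intros x _. ring.
Qed.

Lemma exp_admissible : admissible (fun x => exp (- x)) 1.
Proof.
  split; [| split].
  - intros x Hx. pose proof (exp_ineq1_le (- x)).
    assert (exp (- x) <= 1) by (rewrite <- exp_0; apply exp_le_compat; lra).
    apply Rabs_le. lra.
  - intros x Hx. rewrite Rabs_right by (left; apply exp_pos).
    rewrite exp_Ropp. unfold Rdiv. rewrite Rmult_1_l.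
    pose proof (exp_ineq1_le x). apply Rinv_le_contravar; lra.
  - intros x Hx. reg.
Qed.

Lemma sin_abs_le (x : R) : Rabs (sin x) <= Rabs x.
Proof.
  assert (P : forall y, 0 <= y -> Rabs (sin y) <= y).
  { intros y Hy. destruct (Req_dec y 0) as [-> | Hy0].
    - rewrite sin_0, Rabs_R0. lra.
    - apply Rabs_le. destruct (Rle_dec y 1).
      + pose proof (sin_lt_x y ltac:(lra)).
        pose proof (sin_gt_0 y ltac:(lra) ltac:(pose proof PI_RGT_0; pose proof PI2_1; lra)). lra.
      + pose proof (SIN_bound y). lra. }
  destruct (Rle_dec 0 x) as [Hx | Hx].
  - rewrite (Rabs_right x) by lra. auto.
  - rewrite (Rabs_left x) by lra. rewrite <- (Rabs_Ropp (sin x)), <- sin_neg. apply P. lra.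
Qed.

Lemma cos_half (x : R) : 1 - cos x = 2 * (sin (x / 2) * sin (x / 2)).
Proof.
  replace x with (2 * (x / 2)) at 1 by field. rewrite cos_2a_sin. ring.
Qed.

Lemma one_minus_cos_le (x : R) : 0 <= 1 - cos x <= Rabs x.
Proof.
  split; [pose proof (COS_bound x); lra |]. rewrite cos_half.
  pose proof (sin_abs_le (x / 2)) as H.
  replace (Rabs (x / 2)) with (Rabs x / 2) in H
    by (unfold Rdiv; rewrite Rabs_mult, (Rabs_right (/ 2)) by lra; reflexivity).
  assert (H1 : Rabs (sin (x / 2)) <= 1) by (apply Rabs_le, SIN_bound).
  replace (sin (x / 2) * sin (x / 2)) with (Rabs (sin (x / 2)) * Rabs (sin (x / 2)))
    by (rewrite <- Rabs_mult, Rabs_right; [reflexivity | nra]).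
  pose proof (Rabs_pos (sin (x / 2))). nra.
Qed.

Lemma gamma1_0 : gamma1 0 = 1.
Proof. unfold gamma1. destruct Req_EM_T; lra. Qed.

Lemma gamma1_mul (x : R) : x * gamma1 x = sin x.
Proof.
  unfold gamma1. destruct Req_EM_T as [-> | Hx].
  - rewrite sin_0. ring.
  - field. assumption.
Qed.

Lemma gamma1_opp (x : R) : gamma1 (- x) = gamma1 x.
Proof.
  unfold gamma1. destruct Req_EM_T, Req_EM_T; try lra.
  rewrite sin_neg. field. assumption.
Qed.

Lemma gamma1_abs_le (x : R) : Rabs (gamma1 x) <= 1.
Proof.
  unfold gamma1. destruct Req_EM_T as [_ | Hx].
  - rewrite Rabs_R1. lra.
  - unfold Rdiv. rewrite Rabs_mult, Rabs_inv. pose proof (Rabs_pos_lt x Hx).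
    apply Rmult_le_reg_r with (Rabs x); [assumption |].
    rewrite Rmult_assoc, Rinv_l, Rmult_1_r, Rmult_1_l by lra. apply sin_abs_le.
Qed.

Lemma gamma2_gamma1 (x : R) : gamma2 x = gamma1 (x / 2) ^ 2.
Proof.
  unfold gamma1, gamma2. destruct Req_EM_T, Req_EM_T; lra.
Qed.

Lemma gamma2_mul (x : R) : x ^ 2 / 2 * gamma2 x = 1 - cos x.
Proof.
  rewrite gamma2_gamma1, cos_half, <- gamma1_mul. field.
Qed.

Lemma gamma1_continuity (x : R) : 0 < x -> continuity_pt gamma1 x.
Proof.
  intros Hx. apply (continuity_pt_ext_loc (fun y => sin y / y)).
  - exists (mkposreal x Hx). intros y Hy.
    unfold ball in Hy; simpl in Hy; unfold AbsRing_ball, abs, minus, plus, opp in Hy; simpl in Hy.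
    apply Rabs_def2 in Hy. unfold gamma1. destruct Req_EM_T; [lra | reflexivity].
  - reg. lra.
Qed.

Lemma gamma1_admissible : admissible gamma1 1.
Proof.
  split; [| split].
  - intros x Hx. destruct (Req_dec x 0) as [-> | Hx0].
    { rewrite gamma1_0, Rminus_diag, Rabs_R0. lra. }
    (* This identifies [gamma1 x - 1] with [cos y - 1] for some [y] between 0 and [x]. *)
    destruct (MVT_gen (fun y => sin y - y) 0 x (fun y => cos y - 1)) as [y [Hy E]].
    { intros y _. auto_derive; [exact I | ring]. }
    { intros y _. reg. }
    rewrite Rmin_left, Rmax_right in Hy by lra. rewrite sin_0 in E.
    replace (gamma1 x - 1) with (cos y - 1).
    + pose proof (one_minus_cos_le y) as H. rewrite (Rabs_right y) in H by lra.
      apply Rabs_le. lra.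
    + apply Rmult_eq_reg_r with x; [| assumption].
      replace ((gamma1 x - 1) * x) with (x * gamma1 x - x) by ring.
      rewrite gamma1_mul. lra.
  - intros x Hx. apply Rmult_le_reg_l with x; [assumption |].
    replace (x * Rabs (gamma1 x)) with (Rabs (x * gamma1 x))
      by (rewrite Rabs_mult, (Rabs_right x) by lra; reflexivity).
    rewrite gamma1_mul. replace (x * (1 / x)) with 1 by (field; lra).
    apply Rabs_le, SIN_bound.
  - exact gamma1_continuity.
Qed.

Lemma gamma2_admissible : admissible gamma2 2.
Proof.
  destruct gamma1_admissible as [A0 [Ai Ac]].
  split; [| split].
  - intros x Hx. rewrite gamma2_gamma1. specialize (A0 (x / 2) ltac:(lra)).
    pose proof (gamma1_abs_le (x / 2)) as H.
    replace (gamma1 (x / 2) ^ 2 - 1) with ((gamma1 (x / 2) - 1) * (gamma1 (x / 2) + 1)) by ring.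
    rewrite Rabs_mult. apply Rabs_le_between in H.
    assert (Rabs (gamma1 (x / 2) + 1) <= 2) by (apply Rabs_le; lra).
    pose proof (Rabs_pos (gamma1 (x / 2) - 1)).
    pose proof (Rabs_pos (gamma1 (x / 2) + 1)). nra.
  - intros x Hx. rewrite gamma2_gamma1. specialize (Ai (x / 2) ltac:(lra)).
    pose proof (gamma1_abs_le (x / 2)). pose proof (Rabs_pos (gamma1 (x / 2))).
    replace (1 / (x / 2)) with (2 / x) in Ai by (field; lra).
    rewrite <- RPow_abs. nra.
  - intros x Hx. apply (continuity_pt_ext (fun y => gamma1 (y / 2) * gamma1 (y / 2))).
    + intros y. rewrite gamma2_gamma1. ring.
    + assert (continuity_pt (fun y => gamma1 (y / 2)) x).
      { apply (continuity_pt_comp (fun y => y / 2) gamma1); [reg | apply Ac; lra]. }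
      now apply (continuity_pt_mult (fun y => gamma1 (y / 2)) (fun y => gamma1 (y / 2))).
Qed.

Lemma clamp_between (a b x : R) : a <= b -> a <= Rmax a (Rmin b x) <= b.
Proof. intros H. unfold Rmax, Rmin. repeat destruct Rle_dec; lra. Qed.

Lemma clamp_inside (a b x : R) :
  a < Rmax a (Rmin b x) < b \/ a <= x <= b -> Rmax a (Rmin b x) = x.
Proof. unfold Rmax, Rmin. repeat destruct Rle_dec; lra. Qed.

(** Here [W = T - T ^ 2], so [W * T ^ k] is a difference of two powers of [exp(-x)], that is, of two
    dilates whose means share the limit [s]. The coordinate is injective, so nothing is aliased. *)
Lemma exp_frame (c : nat -> R) (s d Y : R) :
  kernel_lim c (fun x => exp (- x)) s -> 0 < d -> d < Y ->
  exists T S W, null_frame c d Y T S W.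
Proof.
  intros Hs Hd HY.
  exists (fun x => exp (- x)), (fun t => - ln (Rmax (exp (- Y)) (Rmin (exp (- d)) t))),
    (fun x => exp (- x) - exp (- (2 * x))).
  assert (HYd : exp (- Y) <= exp (- d)) by (apply exp_le_compat; lra).
  (* A value strictly inside the clamping range shows that the clamp did not act. *)
  assert (Hfold : forall x, d < - ln (Rmax (exp (- Y)) (Rmin (exp (- d)) (exp (- x)))) < Y ->
            - ln (Rmax (exp (- Y)) (Rmin (exp (- d)) (exp (- x)))) = x).
  { intros x Hx. set (m := Rmax _ _) in *.
    pose proof (clamp_between _ _ (exp (- x)) HYd) as Hm. fold m in Hm.
    pose proof (exp_pos (- Y)).
    assert (Em : m = exp (- x)).
    { apply clamp_inside. left. fold m.
      split; (apply ln_lt_inv; [| | rewrite ln_exp]); try lra; apply exp_pos. }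
    rewrite Em, ln_exp. ring. }
  split; [| split; [| split; [| split; [| split]]]].
  - intros x Hx. split; [left; apply exp_pos |].
    rewrite <- exp_0. apply exp_le_compat. lra.
  - exists (4 * 1). apply majorant_ge_min.
    + intros x Hx. assert (exp (- (2 * x)) <= exp (- x)) by (apply exp_le_compat; lra).
      assert (exp (- x) <= 1) by (rewrite <- exp_0; apply exp_le_compat; lra).
      replace (exp (- (2 * x))) with (exp (- x) * exp (- x)) in *
        by (rewrite <- exp_plus; f_equal; ring).
      pose proof (exp_ineq1_le (- x)). pose proof (exp_pos (- x)).
      rewrite Rabs_right by lra. nra.
    + intros x Hx. destruct exp_admissible as [_ [Hi _]].
      apply Rle_trans with (2 := Hi x Hx).
      assert (exp (- (2 * x)) <= exp (- x)) by (apply exp_le_compat; lra).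
      pose proof (exp_pos (- x)). pose proof (exp_pos (- (2 * x))).
      rewrite !Rabs_right; lra.
  - intros k.
    assert (Hk : forall j, kernel_lim c (fun x => exp (- x) ^ S j) s).
    { intros j. apply kernel_lim_ext with
        (2 := kernel_lim_dilate c _ (INR (S j)) s (lt_0_INR (S j) ltac:(lia)) Hs).
      intros x _. rewrite exp_pow_nat. f_equal. ring. }
    replace 0 with (s + -1 * s) by ring.
    apply kernel_lim_ext with
      (2 := kernel_lim_plus c _ _ _ _ (Hk k) (kernel_lim_scal c _ (-1) _ (Hk (S k)))).
    intros x _. replace (exp (- (2 * x))) with (exp (- x) * exp (- x))
        by (rewrite <- exp_plus; f_equal; ring).
    simpl. ring.
  - intros t Ht. pose proof (clamp_between _ _ t HYd) as Hm.
    pose proof (exp_pos (- Y)). set (m := Rmax _ _) in *. split.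
    + apply (continuity_pt_opp (fun t => ln (Rmax (exp (- Y)) (Rmin (exp (- d)) t)))).
      apply (continuity_pt_comp (fun t => Rmax (exp (- Y)) (Rmin (exp (- d)) t)) ln).
      * apply clamp_continuous.
      * apply derivable_continuous_pt. exists (/ m). apply derivable_pt_lim_ln. fold m. lra.
    + pose proof (ln_le (exp (- Y)) m ltac:(lra) (proj1 Hm)) as H1.
      pose proof (ln_le m (exp (- d)) ltac:(lra) (proj2 Hm)) as H2.
      rewrite ln_exp in H1, H2. lra.
  - intros x Hx. split; [| split].
    + apply derivable_continuous_pt, ex_derive_Reals_0. auto_derive. exact I.
    + assert (exp (- (2 * x)) < exp (- x)) by (apply exp_increasing; lra). lra.
    + rewrite clamp_inside; [rewrite ln_exp; ring |]. right.
      split; apply exp_le_compat; lra.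
  - intros x Hx Hin. rewrite Hfold by assumption. lra.
Qed.

(** * From the Riemann kernels to other kernels *)

(* The families [g a x = sin (a x) / x] (with [e = 0]) and
   [g a x = (1 - cos (a x)) / x^2] (with [e = 1]) are stable under
   multiplication by [cos (o x)], hence under powers of [(1 + cos (o x)) / 2]. *)
Lemma cos_frame (c : nat -> R) (g : R -> R -> R) (v : R -> R) (e d Y : R) :
  (forall a, kernel_lim c (g a) (v a)) ->
  (forall o a x, 0 <= x ->
     cos (o * x) * g a x = / 2 * g (a + o) x + / 2 * g (a - o) x - e * g o x) ->
  (forall o a, v a = / 2 * v (a + o) + / 2 * v (a - o) - e * v o) ->
  (forall o, 0 < o -> exists B, (forall x, 0 <= x -> Rabs (g o x) <= B) /\
                                (forall x, 0 < x -> Rabs (g o x) <= B / x)) ->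
  (forall o x, 0 < o -> 0 < x -> o * x <= PI / 2 -> continuity_pt (g o) x /\ g o x <> 0) ->
  (forall o x y, 0 < o -> 0 < y <= x -> cos (o * x) = cos (o * y) ->
     Rabs (x * g o x) <= Rabs (y * g o y)) ->
  0 < d -> d < Y -> exists T S W, null_frame c d Y T S W.
Proof.
  intros Hlim Hcos Hv Hb Hcn Hfold Hd HY.
  pose proof PI_RGT_0 as HPI.
  (* Now [o Y = PI / 2], so [cos (o x)] is injective and nonnegative on [[d, Y]]. *)
  set (o := PI / (2 * Y)).
  assert (Ho : 0 < o) by (apply Rdiv_lt_0_compat; lra).
  assert (HoY : o * Y = PI / 2) by (unfold o; field; lra).
  assert (Hod : 0 < o * d < PI / 2) by (rewrite <- HoY; split; nra).
  assert (Hcd : 0 < cos (o * d) < 1).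
  { split; [apply cos_gt_0; lra |]. rewrite <- cos_0. apply cos_decreasing_1; lra. }
  (* The range of [cos (o x)] on [[d, Y]] is [[0, cos (o d)]]. Clamping to it keeps away from 1,
     where [acos] is not differentiable. *)
  set (m := fun t => Rmax 0 (Rmin (cos (o * d)) (2 * t - 1))).
  assert (Hm : forall t, 0 <= m t <= cos (o * d)) by (intros t; apply clamp_between; lra).
  set (T := fun x => (1 + cos (o * x)) / 2).
  set (S := fun t => acos (m t) / o).
  (* The factor [1 - cos (o x)] is [2 (1 - T)]: it vanishes at 0 and makes [W * T ^ k] twice the
     difference of two kernels with the same limit. *)
  exists T, S, (fun x => (1 - cos (o * x)) * g o x).
  assert (HSo : forall t, o * S t = acos (m t)) by (intros t; unfold S; field; lra).
  assert (HmT : forall x, m (T x) = Rmax 0 (Rmin (cos (o * d)) (cos (o * x)))).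
  { intros x. unfold m, T. do 2 f_equal. field. }
  split; [| split; [| split; [| split; [| split]]]].
  - intros x Hx. unfold T. pose proof (COS_bound (o * x)). lra.
  - destruct (Hb o Ho) as [B [HB0 HBi]].
    assert (HB : 0 <= B) by (specialize (HB0 0 ltac:(lra)); pose proof (Rabs_pos (g o 0)); lra).
    exists (4 * (B * (o + 2))). apply majorant_ge_min.
    + intros x Hx. rewrite Rabs_mult. specialize (HB0 x Hx).
      pose proof (one_minus_cos_le (o * x)) as H1.
      rewrite (Rabs_right (o * x)) in H1 by nra.
      rewrite (Rabs_right (1 - _)) by lra. pose proof (Rabs_pos (g o x)).
      assert (0 <= B * x) by nra.
      apply Rle_trans with (o * x * B); [| nra].
      apply Rmult_le_compat; lra.
    + intros x Hx. rewrite Rabs_mult. specialize (HBi x Hx).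
      pose proof (COS_bound (o * x)). rewrite (Rabs_right (1 - _)) by lra.
      pose proof (Rabs_pos (g o x)).
      assert (0 <= B / x) by (apply Rdiv_le_0_compat; lra).
      replace (B * (o + 2) / x) with ((o + 2) * (B / x)) by (field; lra).
      apply Rmult_le_compat; lra.
  (* The limit does not depend on [k]: [v] satisfies the recurrence of [g] with the cosine replaced
     by 1. All [a] are treated at once because each factor [T] shifts [a] by [o] both ways. *)
  - assert (Hk : forall k a, kernel_lim c (fun x => g a x * T x ^ k) (v a)).
    { induction k as [|k IH]; intros a.
      - apply kernel_lim_ext with (2 := Hlim a). intros x _. simpl. ring.
      - replace (v a) with (/ 2 * v a + (/ 2 * (/ 2 * v (a + o) + (/ 2 * v (a - o) + - e * v o)))).
        2: { pose proof (Hv o a). lra. }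
        apply kernel_lim_ext with
          (2 := kernel_lim_plus c _ _ _ _ (kernel_lim_scal c _ (/ 2) _ (IH a))
                 (kernel_lim_scal c _ (/ 2) _
                   (kernel_lim_plus c _ _ _ _ (kernel_lim_scal c _ (/ 2) _ (IH (a + o)))
                     (kernel_lim_plus c _ _ _ _ (kernel_lim_scal c _ (/ 2) _ (IH (a - o)))
                        (kernel_lim_scal c _ (- e) _ (IH o)))))).
        intros x Hx.
        replace (g a x * T x ^ Datatypes.S k)
          with (/ 2 * (g a x * T x ^ k) + / 2 * (cos (o * x) * g a x) * T x ^ k)
          by (rewrite <- tech_pow_Rmult; set (p := T x ^ k); unfold T; field).
        rewrite (Hcos o a x Hx). ring. }
    intros k. replace 0 with (2 * (v o + -1 * v o)) by ring.
    apply kernel_lim_ext with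
      (2 := kernel_lim_scal c _ 2 _ (kernel_lim_plus c _ _ _ _ (Hk k o)
              (kernel_lim_scal c _ (-1) _ (Hk (Datatypes.S k) o)))).
    intros x _. rewrite <- tech_pow_Rmult. set (p := T x ^ k). unfold T. field.
  - intros t Ht. split.
    + apply (continuity_pt_mult (fun t => acos (m t)) (fun _ => / o)); [| reg].
      apply (continuity_pt_comp m acos).
      * apply (continuity_pt_comp (fun t => 2 * t - 1) (fun u => Rmax 0 (Rmin (cos (o * d)) u)));
          [reg | apply clamp_continuous].
      * apply derivable_continuous_pt, derivable_pt_acos. specialize (Hm t). lra.
    + specialize (Hm t). specialize (HSo t). pose proof (acos_bound (m t)) as Hab.
      pose proof (cos_acos (m t) ltac:(lra)) as Hca. rewrite <- HSo in Hca, Hab.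
      split; apply Rnot_lt_le; intros Hlt.
      * assert (cos (o * d) < cos (o * S t)) by (apply cos_decreasing_1; nra). lra.
      * assert (cos (o * S t) < cos (PI / 2)).
        { apply cos_decreasing_1; try lra. rewrite <- HoY. nra. }
        rewrite cos_PI2 in *. lra.
  - intros x Hx.
    assert (Hox : o * d <= o * x <= PI / 2) by (rewrite <- HoY; split; nra).
    destruct (Hcn o x Ho ltac:(lra) ltac:(lra)) as [Hgc Hg0]. split; [| split].
    + apply (continuity_pt_mult (fun x => 1 - cos (o * x)) (g o)); [| assumption].
      apply derivable_continuous_pt, ex_derive_Reals_0. auto_derive. exact I.
    + apply Rmult_integral_contrapositive. split; [| assumption].
      assert (cos (o * x) < cos 0) by (apply cos_decreasing_1; lra). rewrite cos_0 in *. lra.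
    + apply Rmult_eq_reg_l with o; [| lra]. rewrite HSo, HmT, clamp_inside.
      * apply acos_cos. lra.
      * right. split; [apply cos_ge_0; lra |]. apply cos_decr_1; lra.
  - intros x Hx Hin.
    set (y := S (T x)) in *.
    assert (Hoy : o * d < o * y < PI / 2) by (rewrite <- HoY; split; nra).
    assert (Hmy : cos (o * y) = m (T x)).
    { unfold y. rewrite HSo. apply cos_acos. specialize (Hm (T x)). lra. }
    assert (Hcy : cos (o * y) = cos (o * x)).
    { rewrite Hmy, HmT. apply clamp_inside. left. rewrite <- HmT, <- Hmy. split.
      - apply cos_gt_0; lra.
      - apply cos_decreasing_1; lra. }
    (* [o y] lies in the first quarter period, where no smaller nonnegative argument has the same
       cosine. *)
    assert (Hyx : y <= x).
    { apply Rnot_lt_le. intros Hlt.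
      assert (cos (o * y) < cos (o * x)) by (apply cos_decreasing_1; nra). lra. }
    split; [assumption |]. rewrite Hcy.
    specialize (Hfold o x y Ho ltac:(lra) ltac:(now symmetry)).
    replace (x * ((1 - cos (o * x)) * g o x)) with ((1 - cos (o * x)) * (x * g o x)) by ring.
    replace (y * ((1 - cos (o * x)) * g o y)) with ((1 - cos (o * x)) * (y * g o y)) by ring.
    rewrite !(Rabs_mult (1 - cos (o * x))).
    apply Rmult_le_compat_l; [apply Rabs_pos | assumption].
Qed.

Lemma kernel_lim_dilate_even (c : nat -> R) (f : R -> R) (s a : R) :
  (forall x, f (- x) = f x) -> a <> 0 ->
  kernel_lim c f s -> kernel_lim c (fun x => f (a * x)) s.
Proof.
  intros He Ha Hf. destruct (Rle_dec 0 a).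
  - apply kernel_lim_dilate; [lra | assumption].
  - apply kernel_lim_ext with (2 := kernel_lim_dilate c f (- a) s ltac:(lra) Hf).
    intros x _. rewrite <- He. f_equal. ring.
Qed.

Lemma gamma1_family (a x : R) : x * (a * gamma1 (a * x)) = sin (a * x).
Proof. rewrite <- (gamma1_mul (a * x)). ring. Qed.

Lemma gamma2_family (a x : R) : x ^ 2 * (a ^ 2 / 2 * gamma2 (a * x)) = 1 - cos (a * x).
Proof. rewrite <- (gamma2_mul (a * x)). field. Qed.

Lemma admissible_bound (f : R -> R) (C a : R) : admissible f C -> 0 < a ->
  (forall x, 0 <= x -> Rabs (f (a * x)) <= 1 + C) /\
  (forall x, 0 < x -> Rabs (f (a * x)) <= C / a / x).
Proof.
  intros [H0 [Hi _]] Ha. split.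
  - intros x Hx. set (y := a * x). assert (Hy : 0 <= y) by (unfold y; nra).
    specialize (H0 y Hy). pose proof (H0) as H1.
    destruct (Rle_dec y 1) as [Hy1 | Hy1].
    + assert (0 <= C * y) by (pose proof (Rabs_pos (f y - 1)); lra).
      assert (C * y <= C).
      { destruct (Req_dec y 0) as [-> | Hy0].
        - specialize (Hi 1 ltac:(lra)). pose proof (Rabs_pos (f 1)). lra.
        - assert (0 <= C) by (apply Rmult_le_reg_r with y; lra). nra. }
      apply Rabs_le_between in H1. apply Rabs_le. lra.
    + specialize (Hi y ltac:(lra)).
      assert (0 <= C).
      { apply Rmult_le_reg_r with (/ y); [apply Rinv_0_lt_compat; lra |].
        pose proof (Rabs_pos (f y)). unfold Rdiv in Hi. lra. }
      assert (/ y <= 1) by (rewrite <- Rinv_1; apply Rinv_le_contravar; lra).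
      unfold Rdiv in Hi. nra.
  - intros x Hx. replace (C / a / x) with (C / (a * x)) by (field; lra). apply Hi. nra.
Qed.

(** [a * gamma1 (a x)] is [sin (a x) / x], extended by its limit [a] at 0; dilation and evenness
    give its means the limit [a * s]. The value [a = 0] occurs among the shifts and gives the zero
    kernel. *)
Lemma gamma1_frame (c : nat -> R) (s d Y : R) :
  kernel_lim c gamma1 s -> 0 < d -> d < Y -> exists T S W, null_frame c d Y T S W.
Proof.
  intros Hs. apply (cos_frame c (fun a x => a * gamma1 (a * x)) (fun a => a * s) 0).
  - intros a. destruct (Req_dec a 0) as [-> | Ha].
    + rewrite Rmult_0_l. apply kernel_lim_ext with (2 := kernel_lim_0 c). intros x _. ring.
    + apply kernel_lim_scal. now apply kernel_lim_dilate_even; [exact gamma1_opp | |].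
  - intros o a x Hx. destruct (Req_dec x 0) as [-> | Hx0].
    + rewrite !Rmult_0_r, cos_0, gamma1_0. field.
    + apply Rmult_eq_reg_l with x; [| assumption].
      transitivity (cos (o * x) * sin (a * x)); [rewrite <- gamma1_family; ring |].
      transitivity (/ 2 * sin ((a + o) * x) + / 2 * sin ((a - o) * x)).
      * rewrite Rmult_plus_distr_r, Rmult_minus_distr_r, sin_plus, sin_minus. field.
      * rewrite <- !gamma1_family. ring.
  - intros o a. field.
  - intros o Ho. exists (2 * o + 1).
    destruct (admissible_bound gamma1 1 o gamma1_admissible Ho) as [H0 Hi]. split.
    + intros x Hx. specialize (H0 x Hx). rewrite Rabs_mult, (Rabs_right o) by lra. nra.
    + intros x Hx. specialize (Hi x Hx). rewrite Rabs_mult, (Rabs_right o) by lra.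
      apply Rle_trans with (o * (1 / o / x)); [apply Rmult_le_compat_l; lra |].
      replace (o * (1 / o / x)) with (1 / x) by (field; lra).
      apply Rmult_le_compat_r; [left; now apply Rinv_0_lt_compat | lra].
  - intros o x Ho Hx Hox. assert (0 < o * x) by nra. split.
    + apply (continuity_pt_mult (fun _ => o) (fun x => gamma1 (o * x))); [reg |].
      apply (continuity_pt_comp (fun x => o * x) gamma1); [reg |].
      now apply gamma1_continuity.
    + intros E. pose proof (gamma1_family o x) as F. rewrite E in F.
      pose proof (sin_gt_0 (o * x) ltac:(lra) ltac:(lra)). lra.
  (* Here [x * g o x] is [sin (o x)], whose square is determined by the cosine. *)
  - intros o x y Ho Hy Hc. rewrite !gamma1_family. right.
    apply Rsqr_eq_abs_0. rewrite !sin2, Hc. reflexivity.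
Qed.

Lemma gamma2_0 : gamma2 0 = 1.
Proof. unfold gamma2. destruct Req_EM_T; lra. Qed.

Lemma gamma2_opp (x : R) : gamma2 (- x) = gamma2 x.
Proof.
  rewrite !gamma2_gamma1. replace (- x / 2) with (- (x / 2)) by field.
  now rewrite gamma1_opp.
Qed.

(** The same with [(1 - cos (a x)) / x ^ 2], extended by [a ^ 2 / 2] at 0. The product formula
    leaves the extra term [1 - cos (o x)], hence [e = 1]. *)
Lemma gamma2_frame (c : nat -> R) (s d Y : R) :
  kernel_lim c gamma2 s -> 0 < d -> d < Y -> exists T S W, null_frame c d Y T S W.
Proof.
  intros Hs. apply (cos_frame c (fun a x => a ^ 2 / 2 * gamma2 (a * x)) (fun a => a ^ 2 / 2 * s) 1).
  - intros a. destruct (Req_dec a 0) as [-> | Ha].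
    + replace (0 ^ 2 / 2 * s) with 0 by field.
      apply kernel_lim_ext with (2 := kernel_lim_0 c). intros x _. field.
    + apply kernel_lim_scal. now apply kernel_lim_dilate_even; [exact gamma2_opp | |].
  - intros o a x Hx. destruct (Req_dec x 0) as [-> | Hx0].
    + rewrite !Rmult_0_r, cos_0, gamma2_0. field.
    + apply Rmult_eq_reg_l with (x ^ 2); [| now apply pow_nonzero].
      transitivity (cos (o * x) * (1 - cos (a * x))); [rewrite <- gamma2_family; ring |].
      transitivity (/ 2 * (1 - cos ((a + o) * x)) + / 2 * (1 - cos ((a - o) * x))
                    - (1 - cos (o * x))).
      * rewrite Rmult_plus_distr_r, Rmult_minus_distr_r, cos_plus, cos_minus. field.
      * rewrite <- !gamma2_family. ring.
  - intros o a. field.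
  - intros o Ho. exists (3 * (o ^ 2 / 2) + o).
    destruct (admissible_bound gamma2 2 o gamma2_admissible Ho) as [H0 Hi].
    assert (Ho2 : 0 <= o ^ 2 / 2) by nra. split.
    + intros x Hx. specialize (H0 x Hx). rewrite Rabs_mult, (Rabs_right (o ^ 2 / 2)) by lra. nra.
    + intros x Hx. specialize (Hi x Hx). rewrite Rabs_mult, (Rabs_right (o ^ 2 / 2)) by lra.
      apply Rle_trans with (o ^ 2 / 2 * (2 / o / x)); [apply Rmult_le_compat_l; lra |].
      replace (o ^ 2 / 2 * (2 / o / x)) with (o / x) by (field; lra).
      apply Rmult_le_compat_r; [left; now apply Rinv_0_lt_compat | lra].
  - intros o x Ho Hx Hox. assert (0 < o * x) by nra. split.
    + apply (continuity_pt_mult (fun _ => o ^ 2 / 2) (fun x => gamma2 (o * x))); [reg |].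
      apply (continuity_pt_comp (fun x => o * x) gamma2); [reg |].
      now apply gamma2_admissible.
    + intros E. pose proof (gamma2_family o x) as F. rewrite E in F.
      pose proof PI_RGT_0.
      assert (cos (o * x) < cos 0) by (apply cos_decreasing_1; lra). rewrite cos_0 in *. lra.
  - intros o x y Ho Hy Hc.
    (* Among points with equal cosines, [(1 - cos (o z)) / z] decreases in [z]. *)
    assert (F : forall z, 0 < z ->
      Rabs (z * (o ^ 2 / 2 * gamma2 (o * z))) = / z * (1 - cos (o * z))).
    { intros z Hz. rewrite <- gamma2_family.
      replace (/ z * (z ^ 2 * (o ^ 2 / 2 * gamma2 (o * z))))
        with (z * (o ^ 2 / 2 * gamma2 (o * z))) by (field; lra).
      apply Rabs_right. rewrite gamma2_gamma1.
      pose proof (pow2_ge_0 (gamma1 (o * z / 2))). pose proof (pow2_ge_0 o).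
      apply Rle_ge. apply Rmult_le_pos; [lra | apply Rmult_le_pos; lra]. }
    rewrite !F, Hc by lra. pose proof (COS_bound (o * y)).
    apply Rmult_le_compat_r; [lra |]. apply Rinv_le_contravar; lra.
Qed.

(** * Riesz and Cesaro means *)

(** The test is strict because [Rpower] takes the value 1 at base 0 ([ln 0] is 0), whereas the
    kernel must vanish at [x = 1]. *)
Definition riesz (beta x : R) : R := if Rlt_dec x 1 then Rpower (1 - x) beta else 0.

Lemma Rpower_le_1 (x y : R) : 0 < x <= 1 -> 0 <= y -> Rpower x y <= 1.
Proof.
  intros Hx Hy. unfold Rpower. rewrite <- exp_0. apply exp_le_compat.
  pose proof (ln_le x 1 ltac:(lra) ltac:(lra)) as H. rewrite ln_1 in H. nra.
Qed.

Lemma riesz_bounds (beta x : R) : 0 < beta -> 0 <= x -> 0 <= riesz beta x <= 1.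
Proof.
  intros Hb Hx. unfold riesz. destruct Rlt_dec; [| lra]. split.
  - left. apply exp_pos.
  - apply Rpower_le_1; lra.
Qed.

Lemma ln_1p_le (u : R) : 0 <= u -> u - u ^ 2 <= ln (1 + u) <= u.
Proof.
  intros Hu. split.
  - pose proof (exp_ineq1_le (ln (/ (1 + u)))) as H.
    rewrite exp_ln, ln_Rinv in H by (try apply Rinv_0_lt_compat; lra).
    enough (/ (1 + u) <= 1 - u + u ^ 2) by lra.
    apply Rmult_le_reg_r with (1 + u); [lra |]. rewrite Rinv_l by lra. nra.
  - pose proof (exp_ineq1_le (ln (1 + u))) as H. rewrite exp_ln in H by lra. lra.
Qed.

Lemma riesz_continuity (beta x : R) : 0 < beta -> continuity_pt (riesz beta) x.
Proof.
  intros Hb. destruct (Rtotal_order x 1) as [Hx | [-> | Hx]].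
  - apply (continuity_pt_ext_loc (fun y => exp (beta * ln (1 - y)))).
    + exists (mkposreal (1 - x) ltac:(lra)). intros y Hy.
      unfold ball in Hy; simpl in Hy; unfold AbsRing_ball, abs, minus, plus, opp in Hy; simpl in Hy.
      apply Rabs_def2 in Hy. unfold riesz. destruct Rlt_dec; [reflexivity | lra].
    + apply derivable_continuous_pt, ex_derive_Reals_0. auto_derive. lra.
  - apply continuity_pt_locally. intros eps.
    exists (mkposreal (Rpower eps (/ beta)) (exp_pos _)). intros y Hy.
    unfold ball in Hy; simpl in Hy; unfold AbsRing_ball, abs, minus, plus, opp in Hy; simpl in Hy.
    apply Rabs_def2 in Hy. unfold riesz. destruct (Rlt_dec 1 1); [lra |].
    rewrite Rminus_0_r. destruct Rlt_dec as [Hy1 |]; [| rewrite Rabs_R0; apply cond_pos].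
    rewrite Rabs_right by (left; apply exp_pos).
    replace (pos eps) with (Rpower (Rpower eps (/ beta)) beta).
    + apply Rlt_Rpower_l; lra.
    + rewrite Rpower_mult, Rinv_l, Rpower_1; [reflexivity | apply cond_pos | lra].
  - apply (continuity_pt_ext_loc (fun _ => 0)).
    + exists (mkposreal (x - 1) ltac:(lra)). intros y Hy.
      unfold ball in Hy; simpl in Hy; unfold AbsRing_ball, abs, minus, plus, opp in Hy; simpl in Hy.
      apply Rabs_def2 in Hy. unfold riesz. destruct Rlt_dec; [lra | reflexivity].
    + reg.
Qed.

(** On [[0, 1/2]], [ln (1 - x) >= - 2 x] gives [1 - riesz beta x <= 2 beta x]; beyond, the
    difference from 1 is at most [1 <= 2 x]. The decay holds because the kernel is at most 1 and
    vanishes from 1 on. *)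
Lemma riesz_admissible (beta : R) : 0 < beta -> admissible (riesz beta) (2 * beta + 2).
Proof.
  intros Hb. split; [| split].
  - intros x Hx. pose proof (riesz_bounds beta x Hb Hx) as H.
    destruct (Rle_dec x (/ 2)) as [Hx2 | Hx2].
    + unfold riesz in *. destruct Rlt_dec; [| lra].
      pose proof (exp_ineq1_le (beta * ln (1 - x))) as He. unfold Rpower in *.
      assert (Hl : - (2 * x) <= ln (1 - x)).
      { rewrite <- (ln_exp (- (2 * x))). apply ln_le; [apply exp_pos |].
        rewrite exp_Ropp. pose proof (exp_ineq1_le (2 * x)).
        apply Rle_trans with (/ (1 + 2 * x)).
        - apply Rinv_le_contravar; lra.
        - apply Rmult_le_reg_r with (1 + 2 * x); [lra |]. rewrite Rinv_l by lra. nra. }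
      apply Rabs_le. nra.
    + apply Rabs_le. nra.
  - intros x Hx. pose proof (riesz_bounds beta x Hb ltac:(lra)) as H.
    rewrite Rabs_right by lra. assert (0 < / x) by now apply Rinv_0_lt_compat.
    unfold Rdiv. unfold riesz in *. destruct Rlt_dec; [| nra].
    assert (1 < / x) by (rewrite <- Rinv_1; apply Rinv_lt_contravar; lra). nra.
  - intros x _. now apply riesz_continuity.
Qed.

(** * Asymptotics of the Cesaro numbers *)

Lemma cesA_pos (beta : R) (n : nat) : 0 < beta -> 0 < cesA beta n.
Proof.
  intros Hb. induction n as [|n IH]; cbn [cesA]; [lra |].
  pose proof (lt_0_INR (S n) ltac:(lia)).
  apply Rmult_lt_0_compat; [assumption | apply Rdiv_lt_0_compat; lra].
Qed.

(** The increments of [ln (cesA n) - beta ln (n + 1)] are [O(1 / (n + 1) ^ 2)]. The telescoping form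
    of the bound makes their sum explicit and avoids the Gamma function. *)
Lemma ln_cesA_step (beta : R) (n : nat) : 0 < beta ->
  Rabs (ln (cesA beta (S n)) - ln (cesA beta n) - beta * (ln (INR n + 2) - ln (INR n + 1)))
  <= 2 * (beta + beta ^ 2) * (/ (INR n + 1) - / (INR n + 2)).
Proof.
  intros Hb. pose proof (pos_INR n) as Hn. pose proof (cesA_pos beta n Hb).
  cbn [cesA]. rewrite S_INR. set (j := INR n + 1). assert (Hj : 1 <= j) by (unfold j; lra).
  replace (INR n + 2) with (j + 1) by (unfold j; ring).
  rewrite ln_mult by (try assumption; apply Rdiv_lt_0_compat; lra).
  replace ((beta + j) / j) with (1 + beta / j) by (field; lra).
  replace (ln (j + 1)) with (ln j + ln (1 + / j))
    by (rewrite <- ln_mult by (pose proof (Rinv_0_lt_compat j); lra); f_equal; field; lra).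
  assert (Hij : 0 < / j) by (apply Rinv_0_lt_compat; lra).
  pose proof (ln_1p_le (beta / j) ltac:(unfold Rdiv; nra)) as H1.
  pose proof (ln_1p_le (/ j) ltac:(lra)) as H2.
  assert (H3 : (/ j) ^ 2 <= 2 * (/ j - / (j + 1))).
  { apply Rmult_le_reg_r with (j ^ 2 * (j + 1)); [apply Rmult_lt_0_compat; nra |].
    replace ((/ j) ^ 2 * (j ^ 2 * (j + 1))) with (j + 1) by (field; lra).
    replace (2 * (/ j - / (j + 1)) * (j ^ 2 * (j + 1))) with (2 * j) by (field; lra). lra. }
  assert (Hb2 : 0 < beta + beta ^ 2) by nra.
  apply Rle_trans with ((beta + beta ^ 2) * (/ j) ^ 2).
  - unfold Rdiv in H1. replace ((beta * / j) ^ 2) with (beta ^ 2 * (/ j) ^ 2) in H1 by ring.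
    pose proof (pow2_ge_0 (/ j)). unfold Rdiv. apply Rabs_le. nra.
  - nra.
Qed.

Lemma ln_cesA_diff (beta : R) (m k : nat) : 0 < beta ->
  Rabs (ln (cesA beta (m + k)) - ln (cesA beta m)
        - beta * (ln (INR (m + k) + 1) - ln (INR m + 1)))
  <= 2 * (beta + beta ^ 2) * (/ (INR m + 1) - / (INR (m + k) + 1)).
Proof.
  intros Hb. induction k as [|k IH].
  - rewrite Nat.add_0_r, !Rminus_diag, Rmult_0_r, Rminus_0_r, Rabs_R0. lra.
  - rewrite Nat.add_succ_r. pose proof (ln_cesA_step beta (m + k) Hb) as H.
    rewrite S_INR. replace (INR (m + k) + 1 + 1) with (INR (m + k) + 2) by ring.
    apply Rabs_le_between in H. apply Rabs_le_between in IH. apply Rabs_le. lra.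
Qed.

Lemma exp_minus_1_le (u M : R) : Rabs u <= M -> Rabs (exp u - 1) <= Rabs u * exp M.
Proof.
  intros H. pose proof (exp_ineq1_le u) as Hu. pose proof (exp_ineq1_le (- u)) as H1.
  rewrite exp_Ropp in H1. pose proof (exp_pos u) as Hp.
  assert (H2 : exp u - 1 <= u * exp u).
  { apply Rmult_le_compat_r with (r := exp u) in H1; [| lra]. rewrite Rinv_l in H1 by lra. lra. }
  assert (1 <= exp M).
  { rewrite <- exp_0. apply exp_le_compat. pose proof (Rabs_pos u). lra. }
  assert (exp u <= exp M) by (apply exp_le_compat; pose proof (Rle_abs u); lra).
  destruct (Rle_dec 0 u).
  - rewrite (Rabs_right u) by lra. rewrite Rabs_right by lra. nra.
  - rewrite (Rabs_left u) by lra. rewrite Rabs_left1.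
    + nra.
    + assert (exp u <= exp 0) by (apply exp_le_compat; lra). rewrite exp_0 in *. lra.
Qed.

(** With [m = n - k] and [rho = (m + 1) / (n + 1)], the ratio is [exp u * rho ^ beta] with
    [|u| <= M / (m + 1)], so the error is at most a multiple of [rho ^ beta / (m + 1)]. The factor
    [majorant] allows summation against [c]; the negative power of [n + 1] makes the sum tend to
    0. *)
Lemma cesA_ratio_riesz (beta : R) : 0 < beta -> exists E, 0 <= E /\
  forall n k, (k <= n)%nat ->
    Rabs (cesA beta (n - k) / cesA beta n - riesz beta (INR k * / (INR n + 1)))
    <= E * Rpower (INR n + 1) (- Rmin beta (/ 2)) * majorant (INR k * / (INR n + 1)).
Proof.
  intros Hb. set (M := 2 * (beta + beta ^ 2)).
  assert (HM : 0 <= M) by (unfold M; nra).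
  exists (8 * (M * exp M)).
  assert (HE : 0 <= M * exp M) by (apply Rmult_le_pos; [assumption | left; apply exp_pos]).
  split; [lra |]. intros n k Hk.
  set (b := Rmin beta (/ 2)).
  assert (Hbb : 0 < b /\ b <= beta /\ b <= / 2).
  { unfold b. split; [apply Rmin_pos; lra |]. split; [apply Rmin_l | apply Rmin_r]. }
  pose proof (pos_INR n) as Hn. pose proof (pos_INR k) as Hk0.
  set (N := INR n + 1) in *. assert (HN : 1 <= N) by (unfold N; lra).
  set (m := (n - k)%nat). assert (Hm : INR m = INR n - INR k) by (apply minus_INR; assumption).
  pose proof (pos_INR m) as Hm0.
  pose proof (cesA_pos beta m Hb) as HAm. pose proof (cesA_pos beta n Hb) as HAn.
  set (x := INR k * / N).
  set (rho := (INR m + 1) / N).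
  assert (Hrho : 1 - x = rho) by (unfold x, rho, N; rewrite Hm; field; lra).
  assert (Hrho0 : 0 < rho) by (unfold rho; apply Rdiv_lt_0_compat; lra).
  assert (HiN : 0 < / N) by (apply Rinv_0_lt_compat; lra).
  assert (Hx0 : 0 <= x) by (unfold x; nra).
  assert (Hlnr : ln rho = ln (INR m + 1) - ln N).
  { unfold rho, Rdiv. rewrite ln_mult, ln_Rinv by lra. ring. }
  pose proof (ln_cesA_diff beta m k Hb) as HD.
  replace (m + k)%nat with n in HD by (unfold m; lia). fold N M in HD.
  set (u := ln (cesA beta m) - ln (cesA beta n) - beta * ln rho).
  assert (HuM : Rabs u <= M * / (INR m + 1)).
  { replace (Rabs u) with (Rabs (ln (cesA beta n) - ln (cesA beta m)
        - beta * (ln N - ln (INR m + 1)))).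
    - nra.
    - rewrite <- Rabs_Ropp. f_equal. unfold u. rewrite Hlnr. ring. }
  assert (Him : 0 < / (INR m + 1) <= 1).
  { split; [apply Rinv_0_lt_compat; lra |].
    apply Rle_trans with (/ 1); [apply Rinv_le_contravar; lra | lra]. }
  pose proof (exp_minus_1_le u M ltac:(nra)) as Hexp.
  assert (Eq : cesA beta m / cesA beta n = exp u * Rpower rho beta).
  { unfold Rpower. rewrite <- exp_plus. unfold u.
    replace (ln (cesA beta m) - ln (cesA beta n) - beta * ln rho + beta * ln rho)
      with (ln (cesA beta m) + - ln (cesA beta n)) by ring.
    rewrite exp_plus, exp_Ropp, !exp_ln by assumption. reflexivity. }
  assert (Hr : riesz beta x = Rpower rho beta).
  { unfold riesz. destruct Rlt_dec; [now rewrite Hrho | lra]. }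
  rewrite Eq, Hr.
  replace (exp u * Rpower rho beta - Rpower rho beta) with ((exp u - 1) * Rpower rho beta) by ring.
  rewrite Rabs_mult, (Rabs_right (Rpower rho beta)) by (left; apply exp_pos).
  assert (HP : 0 < Rpower rho beta <= 1) by (split; [apply exp_pos | apply Rpower_le_1; lra]).
  assert (H1 : Rabs (exp u - 1) * Rpower rho beta
               <= M * exp M * (/ (INR m + 1) * Rpower rho beta)).
  { pose proof (exp_pos M).
    replace (M * exp M * (/ (INR m + 1) * Rpower rho beta))
      with (M * / (INR m + 1) * exp M * Rpower rho beta) by ring.
    apply Rmult_le_compat_r; [lra |]. nra. }
  (* At [k = 0] the majorant vanishes, so the error has to be exactly 0; indeed [u = 0]. *)
  destruct (Nat.eq_dec k 0) as [Hk00 | Hk00].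
  { assert (Hu0 : u = 0).
    { assert (Em : m = n) by (unfold m; lia). unfold u. rewrite Em.
      replace rho with 1; [rewrite ln_1; ring |]. unfold rho. rewrite Em. unfold N. field. lra. }
    rewrite Hu0, exp_0, Rminus_diag, Rabs_R0, Rmult_0_l.
    apply Rmult_le_pos; [| apply majorant_ge0].
    apply Rmult_le_pos; [lra | left; apply exp_pos]. }
  assert (Hx1 : x <= 1) by lra.
  assert (Hxs : sqrt x <= 4 * majorant x).
  { pose proof (majorant_ge_small x x ltac:(lra) ltac:(lra)) as Hs.
    assert (0 < x).
    { unfold x. apply Rmult_lt_0_compat; [| assumption]. apply lt_0_INR. lia. }
    apply Rmult_le_reg_l with (sqrt x); [now apply sqrt_lt_R0 |].
    rewrite sqrt_sqrt by assumption. lra. }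
  (* For [x <= 1/2], [m + 1 >= N / 2], and [1 / N] splits into two factors [1 / sqrt N], one at most
     [sqrt x] because [k >= 1]. For [x > 1/2], the exponent is lowered to [b], so that [1 / (m + 1)]
     absorbs [(m + 1) ^ b]. *)
  assert (H2 : / (INR m + 1) * Rpower rho beta <= 2 * Rpower N (- b) * sqrt x).
  { destruct (Rle_dec x (/ 2)) as [Hx2 | Hx2].
    - apply Rle_trans with (2 * / N).
      + replace (INR m + 1) with (rho * N) by (unfold rho; field; lra).
        rewrite Rinv_mult.
        assert (/ rho <= 2).
        { replace 2 with (/ / 2) by field. apply Rinv_le_contravar; lra. }
        assert (0 < / rho) by now apply Rinv_0_lt_compat.
        apply Rle_trans with (/ rho * / N * 1); [apply Rmult_le_compat_l; nra |]. nra.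
      + assert (/ N <= x).
        { unfold x. assert (1 <= INR k) by (apply (le_INR 1); lia). nra. }
        assert (Hs : / sqrt N <= sqrt x).
        { rewrite <- sqrt_inv. now apply sqrt_le_1_alt. }
        assert (Hp : / sqrt N <= Rpower N (- b)).
        { rewrite <- Rpower_sqrt by lra. rewrite <- Rpower_Ropp.
          apply Rle_Rpower; lra. }
        assert (0 < / sqrt N) by (apply Rinv_0_lt_compat, sqrt_lt_R0; lra).
        replace (/ N) with (/ sqrt N * / sqrt N)
          by (rewrite <- Rinv_mult, sqrt_sqrt by lra; reflexivity).
        rewrite Rmult_assoc. apply Rmult_le_compat_l; [lra |].
        apply Rmult_le_compat; lra.
    - apply Rle_trans with (Rpower N (- b)).
      + assert (Hb1 : Rpower rho beta <= Rpower rho b).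
        { unfold Rpower. apply exp_le_compat.
          pose proof (ln_le rho 1 Hrho0 ltac:(lra)) as Hl. rewrite ln_1 in Hl. nra. }
        assert (Hb2 : Rpower rho b = Rpower (INR m + 1) b * Rpower N (- b)).
        { unfold Rpower. rewrite <- exp_plus, Hlnr. f_equal. ring. }
        assert (Hb3 : Rpower (INR m + 1) b <= INR m + 1).
        { rewrite <- (Rpower_1 (INR m + 1)) at 2 by lra. apply Rle_Rpower; lra. }
        assert (0 < Rpower N (- b)) by apply exp_pos.
        apply Rle_trans with (/ (INR m + 1) * ((INR m + 1) * Rpower N (- b))).
        * apply Rmult_le_compat_l; [lra |]. nra.
        * right. field. lra.
      + assert (/ 2 <= sqrt x).
        { rewrite <- (sqrt_square (/ 2)) by lra. apply sqrt_le_1_alt. lra. }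
        assert (0 < Rpower N (- b)) by apply exp_pos. nra. }
  apply Rle_trans with (1 := H1).
  assert (0 < Rpower N (- b)) by apply exp_pos.
  apply Rle_trans with (M * exp M * (2 * Rpower N (- b) * (4 * majorant x))).
  - apply Rmult_le_compat_l; [assumption |]. nra.
  - right. ring.
Qed.

(** * Cesaro means between Riesz and Abel means *)

Lemma is_series_finite_support (u : nat -> R) (N : nat) :
  (forall n, (N < n)%nat -> u n = 0) -> is_series u (sum_n u N).
Proof.
  intros H.
  assert (E : forall n, (N <= n)%nat -> sum_n u N = sum_n u n).
  { intros n Hn. induction Hn as [|n Hn IH]; [reflexivity |].
    now rewrite sum_n_RS, <- IH, H, Rplus_0_r by lia. }
  apply (filterlim_ext_loc (fun _ => sum_n u N)); [| apply filterlim_const].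
  exists N. exact E.
Qed.

Definition cesaro_mean (beta : R) (c : nat -> R) (n : nat) : R :=
  sum_n (fun k => cesA beta (n - k) * c k) n / cesA beta n.

Lemma Rpower_to_0 (b eps : R) : 0 < b -> 0 < eps ->
  exists N, forall n, (N <= n)%nat -> Rpower (INR n + 1) (- b) < eps.
Proof.
  intros Hb He. destruct (INR_unbounded (Rpower eps (- / b))) as [N HN].
  exists N. intros n Hn. apply le_INR in Hn.
  assert (0 < Rpower eps (- / b)) by apply exp_pos.
  replace eps with (Rpower (Rpower eps (- / b)) (- b)).
  - rewrite !(Rpower_Ropp _ b). apply Rinv_lt_contravar.
    + apply Rmult_lt_0_compat; apply exp_pos.
    + apply Rlt_Rpower_l; lra.
  - rewrite Rpower_mult. replace (- / b * - b) with 1 by (field; lra). now apply Rpower_1.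
Qed.

(** At [h = 1 / (n + 1)] the Riesz mean is a sum over [k <= n], and it differs from the Cesaro mean
    by at most [2 K E q] with [q -> 0]. *)
Lemma cesaro_of_riesz (c : nat -> R) (K beta s : R) :
  linear_mean c K -> 0 < beta -> kernel_lim c (riesz beta) s ->
  is_lim_seq (cesaro_mean beta c) s.
Proof.
  intros Hc Hb [_ Hlim]. pose proof (linear_mean_ge0 c K Hc) as HK.
  destruct (cesA_ratio_riesz beta Hb) as [E [HE HR]].
  apply is_lim_seq_spec. intros eps. pose proof (cond_pos eps) as He.
  destruct (Hlim (eps / 2) ltac:(lra)) as [d [Hd H1]].
  assert (Hbb : 0 < Rmin beta (/ 2)) by (apply Rmin_pos; lra).
  destruct (Rpower_to_0 _ (eps / 2 / (2 * K * E + 1)) Hbb) as [N1 HN1].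
  { apply Rdiv_lt_0_compat; [lra |].
    assert (0 <= K * E) by (apply Rmult_le_pos; lra). lra. }
  destruct (INR_unbounded (/ d)) as [N2 HN2].
  exists (Nat.max N1 N2). intros n Hn.
  specialize (HN1 n ltac:(lia)). assert (Hn2 : (N2 <= n)%nat) by lia. apply le_INR in Hn2.
  assert (0 < / d) by now apply Rinv_0_lt_compat.
  set (h := / (INR n + 1)). pose proof (pos_INR n).
  assert (Hh : 0 < h < d).
  { split; [apply Rinv_0_lt_compat; lra |]. unfold h. rewrite <- (Rinv_inv d).
    apply Rinv_lt_contravar; [apply Rmult_lt_0_compat; lra | lra]. }
  specialize (H1 h Hh).
  assert (Hks : kernel_sum c (riesz beta) h = sum_n (fun k => c k * riesz beta (INR k * h)) n).
  { apply is_series_unique, is_series_finite_support. intros k Hk.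
    unfold riesz. destruct Rlt_dec as [Hlt |]; [exfalso | ring].
    apply lt_INR in Hk. assert (INR n + 1 <= INR k).
    { rewrite <- S_INR. apply le_INR. apply INR_lt in Hk. lia. }
    assert (INR k * h >= (INR n + 1) * h) by nra.
    replace ((INR n + 1) * h) with 1 in * by (unfold h; field; lra). lra. }
  set (q := Rpower (INR n + 1) (- Rmin beta (/ 2))) in *.
  assert (Hdiff : Rabs (cesaro_mean beta c n - kernel_sum c (riesz beta) h) <= 2 * K * E * q).
  { rewrite Hks. unfold cesaro_mean, Rdiv.
    rewrite !sum_n_Reals, (Rmult_comm _ (/ cesA beta n)), scal_sum, <- minus_sum.
    apply Rle_trans with (1 := Rsum_abs _ _).
    apply Rle_trans with (E * q * sum_n (fun k => Rabs (c k) * majorant (INR k * h)) n).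
    - rewrite sum_n_Reals, scal_sum. apply sum_Rle. intros k Hk.
      replace (cesA beta (n - k) * c k * / cesA beta n - c k * riesz beta (INR k * h))
        with (c k * (cesA beta (n - k) / cesA beta n - riesz beta (INR k * h)))
        by (unfold Rdiv; ring).
      rewrite Rabs_mult. specialize (HR n k Hk). fold h q in HR.
      pose proof (Rabs_pos (c k)).
      replace (Rabs (c k) * majorant (INR k * h) * (E * q))
        with (Rabs (c k) * (E * q * majorant (INR k * h))) by ring.
      apply Rmult_le_compat_l; assumption.
    - pose proof (majorant_sum c K h n Hc ltac:(lra)).
      assert (0 <= E * q) by (apply Rmult_le_pos; [assumption | left; apply exp_pos]). nra. }
  assert (2 * K * E * q < eps / 2).
  { assert (0 <= K * E) by (apply Rmult_le_pos; lra).
    assert (0 < q) by apply exp_pos.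
    apply Rmult_lt_compat_r with (r := 2 * K * E + 1) in HN1; [| lra].
    replace (eps / 2 / (2 * K * E + 1) * (2 * K * E + 1)) with (eps / 2) in HN1 by (field; lra).
    nra. }
  replace (cesaro_mean beta c n - s) with
    (cesaro_mean beta c n - kernel_sum c (riesz beta) h + (kernel_sum c (riesz beta) h - s)) by ring.
  apply Rle_lt_trans with (1 := Rabs_triang _ _). lra.
Qed.

Lemma cesA_ge_1 (beta : R) (n : nat) : 0 < beta -> 1 <= cesA beta n.
Proof.
  intros Hb. induction n as [|n IH]; cbn [cesA]; [lra |].
  pose proof (lt_0_INR (S n) ltac:(lia)).
  replace ((beta + INR (S n)) / INR (S n)) with (1 + beta / INR (S n)) by (field; lra).
  assert (0 < beta / INR (S n)) by (apply Rdiv_lt_0_compat; lra). nra.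
Qed.

Lemma cesA_pow_summable (beta r : R) : 0 < beta -> 0 < r < 1 ->
  ex_series (fun n => Rabs (cesA beta n * r ^ n)).
Proof.
  intros Hb Hr. apply ex_series_DAlembert with r; [lra | |].
  - intros n. apply Rmult_integral_contrapositive. split.
    + pose proof (cesA_pos beta n Hb). lra.
    + apply pow_nonzero. lra.
  - apply (is_lim_seq_ext (fun n => r * (1 + beta * / (INR n + 1)))).
    + intros n. pose proof (cesA_pos beta n Hb). pose proof (pos_INR n).
      pose proof (pow_lt r n ltac:(lra)).
      cbn [cesA]. rewrite S_INR, <- tech_pow_Rmult.
      replace (cesA beta n * ((beta + (INR n + 1)) / (INR n + 1)) * (r * r ^ n)
               / (cesA beta n * r ^ n)) with (r * (1 + beta * / (INR n + 1)))
        by (field; repeat split; lra).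
      symmetry. apply Rabs_right.
      assert (0 < / (INR n + 1)) by (apply Rinv_0_lt_compat; lra).
      apply Rle_ge, Rmult_le_pos; nra.
    + replace (Finite r) with (Finite (r * (1 + beta * 0))) by (f_equal; ring).
      apply (is_lim_seq_scal_l _ r (1 + beta * 0)).
      apply is_lim_seq_plus'; [apply is_lim_seq_const |].
      apply (is_lim_seq_scal_l _ beta 0).
      replace (Finite 0) with (Rbar_inv p_infty) by reflexivity.
      apply is_lim_seq_inv; [| discriminate].
      apply (is_lim_seq_ext (fun n => INR (S n))); [intros n; apply S_INR |].
      apply -> (is_lim_seq_incr_1 INR). apply is_lim_seq_INR.
Qed.

(* Abel means are weighted averages of the Cesaro means, with the weights
   [cesA n * r^n], by the Cauchy product. *)
Lemma abel_of_cesaro (c : nat -> R) (K beta s : R) :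
  linear_mean c K -> 0 < beta -> is_lim_seq (cesaro_mean beta c) s ->
  kernel_lim c (fun x => exp (- x)) s.
Proof.
  intros Hc Hb Hlim. destruct exp_admissible as [_ [Hi _]].
  split; [now apply kernel_ex_series with (1 := Hc) (2 := Hi) |].
  intros eps He. apply is_lim_seq_spec in Hlim.
  destruct (Hlim (mkposreal (eps / 2) ltac:(lra))) as [N HN]. simpl in HN.
  set (A := cesA beta) in *. set (sg := cesaro_mean beta c) in *.
  assert (HA : forall n, 1 <= A n) by (intros n; now apply cesA_ge_1).
  (* The finitely many Cesaro means not yet near [s] contribute at most [B], uniformly in [r]. *)
  set (b := fun n => if Compare_dec.le_dec n N then A n * Rabs (sg n - s) else 0).
  assert (Hbpos : forall n, 0 <= b n).
  { intros n. unfold b. destruct Compare_dec.le_dec; [| lra].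
    apply Rmult_le_pos; [specialize (HA n); lra | apply Rabs_pos]. }
  assert (Hbs : is_series b (sum_n b N)).
  { apply is_series_finite_support. intros n Hn. unfold b. destruct Compare_dec.le_dec; [lia | reflexivity]. }
  set (B := sum_n b N) in *.
  assert (HB : 0 <= B).
  { unfold B. rewrite sum_n_Reals. apply cond_pos_sum. exact Hbpos. }
  exists (eps / 2 / (B + 1)). split; [apply Rdiv_lt_0_compat; lra |]. intros h Hh.
  set (r := exp (- h)).
  assert (Hr : 0 < r < 1).
  { split; [apply exp_pos |]. unfold r. rewrite <- exp_0. apply exp_increasing. lra. }
  assert (Hpow : forall n, exp (- (INR n * h)) = r ^ n).
  { intros n. unfold r. rewrite exp_pow_nat. f_equal. ring. }
  assert (Hrh : 1 - r <= h) by (pose proof (exp_ineq1_le (- h)) as Hx; fold r in Hx; lra).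
  set (f := kernel_sum c (fun x => exp (- x)) h).
  assert (Habs : ex_series (fun n => Rabs (c n * r ^ n))).
  { assert (Hc' : linear_mean (fun n => Rabs (c n)) K).
    { intros M. eapply Rle_trans; [| exact (Hc M)]. right. apply sum_n_ext. intros n.
      now rewrite Rabs_Rabsolu. }
    apply (ex_series_ext (fun n => Rabs (c n) * exp (- (INR n * h)))).
    - intros n. rewrite Rabs_mult, Hpow. f_equal. symmetry. apply Rabs_right.
      left. apply pow_lt. lra.
    - apply (kernel_ex_series (fun n => Rabs (c n)) K 1 (fun x => exp (- x)) Hc' Hi). lra. }
  assert (Hf : is_series (fun n => c n * r ^ n) f).
  { unfold f, kernel_sum. rewrite (Series_ext _ (fun n => c n * r ^ n)).
    - apply Series_correct. now apply ex_series_Rabs.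
    - intros n. now rewrite Hpow. }
  pose proof (cesA_pow_summable beta r Hb Hr) as HAabs. fold A in HAabs.
  set (F := Series (fun n => A n * r ^ n)).
  assert (HF : is_series (fun n => A n * r ^ n) F).
  { apply Series_correct. now apply ex_series_Rabs. }
  (* The total weight [F] is at least [1 / (1 - r) >= 1 / h], which makes [B] negligible against
     it. *)
  assert (HFge : 1 <= F * (1 - r)).
  { assert (/ (1 - r) <= F).
    { rewrite <- Series_geom by (rewrite Rabs_right; lra).
      apply Series_le; [| now exists F].
      intros n. pose proof (pow_lt r n ltac:(lra)). specialize (HA n). nra. }
    apply Rmult_le_compat_r with (r := 1 - r) in H; [| lra]. rewrite Rinv_l in H; lra. }
  pose proof (is_series_mult _ _ _ _ Hf HF Habs HAabs) as HP.
  assert (Hterm : forall n,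
    sum_f_R0 (fun k => c k * r ^ k * (A (n - k)%nat * r ^ (n - k))) n = A n * r ^ n * sg n).
  { intros n. unfold sg, cesaro_mean. fold A. pose proof (HA n).
    replace (A n * r ^ n * (sum_n (fun k => A (n - k)%nat * c k) n / A n))
      with (r ^ n * sum_n (fun k => A (n - k)%nat * c k) n) by (field; lra).
    rewrite sum_n_Reals, scal_sum. apply sum_eq. intros k Hk.
    replace (r ^ n) with (r ^ k * r ^ (n - k)); [ring |].
    rewrite <- pow_add. f_equal. lia. }
  apply (is_series_ext _ _ _ Hterm) in HP.
  assert (HD : is_series (fun n => A n * r ^ n * (sg n - s)) (f * F - s * F)).
  { apply (is_series_ext (fun n => minus (A n * r ^ n * sg n) (scal s (A n * r ^ n)))).
    - intros n. unfold minus, plus, opp, scal; simpl. unfold mult; simpl. ring.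
    - apply (is_series_minus (V := R_NormedModule)); [assumption |].
      now apply (is_series_scal (V := R_NormedModule) s). }
  assert (Hmaj : is_series (fun n => eps / 2 * (A n * r ^ n) + b n) (eps / 2 * F + B)).
  { apply (is_series_plus (V := R_NormedModule) (fun n => eps / 2 * (A n * r ^ n)) b); [| assumption].
    now apply (is_series_scal (V := R_NormedModule) (eps / 2)). }
  assert (Hle : forall n, Rabs (A n * r ^ n * (sg n - s)) <= eps / 2 * (A n * r ^ n) + b n).
  { intros n. rewrite Rabs_mult. pose proof (pow_lt r n ltac:(lra)) as Hp.
    specialize (HA n). assert (0 < A n * r ^ n) by nra.
    rewrite (Rabs_right (A n * r ^ n)) by lra. pose proof (Rabs_pos (sg n - s)).
    unfold b. destruct Compare_dec.le_dec as [Hn | Hn].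
    - assert (r ^ n <= 1) by (rewrite <- (pow1 n); apply pow_incr; lra).
      assert (A n * r ^ n <= A n) by nra. nra.
    - specialize (HN n ltac:(lia)). nra. }
  assert (Hfin : Rabs (f * F - s * F) <= eps / 2 * F + B).
  { rewrite <- (is_series_unique _ _ HD), <- (is_series_unique _ _ Hmaj).
    assert (Hex : ex_series (fun n => Rabs (A n * r ^ n * (sg n - s)))).
    { apply ex_series_Rabs_le with (fun n => eps / 2 * (A n * r ^ n) + b n).
      - intros n. rewrite Rabs_Rabsolu. apply Hle.
      - eexists. exact Hmaj. }
    apply Rle_trans with (1 := Series_Rabs _ Hex).
    apply Series_le; [| eexists; exact Hmaj].
    intros n. split; [apply Rabs_pos | apply Hle]. }
  assert (HFpos : 0 < F) by nra.
  replace (f * F - s * F) with ((f - s) * F) in Hfin by ring.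
  rewrite Rabs_mult, (Rabs_right F) in Hfin by lra.
  assert (HBh : B * h < eps / 2).
  { destruct Hh as [Hh0 Hh1]. apply Rmult_lt_compat_r with (r := B + 1) in Hh1; [| lra].
    replace (eps / 2 / (B + 1) * (B + 1)) with (eps / 2) in Hh1 by (field; lra). nra. }
  apply Rmult_lt_reg_r with F; [assumption |].
  apply Rle_lt_trans with (1 := Hfin).
  assert (B <= B * h * F) by (assert (1 <= h * F) by nra; nra).
  nra.
Qed.

(** * Complex series *)

Lemma filterlim_C_iff {T : Type} (F : (T -> Prop) -> Prop) {FF : Filter F} (f : T -> C) (l : C) :
  filterlim f F (locally l) <->
  filterlim (fun t => fst (f t)) F (locally (fst l)) /\
  filterlim (fun t => snd (f t)) F (locally (snd l)).
Proof.
  split.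
  - intros H. split.
    + apply filterlim_comp with (1 := H). intros P [e He]. exists e. intros y Hy. apply He, Hy.
    + apply filterlim_comp with (1 := H). intros P [e He]. exists e. intros y Hy. apply He, Hy.
  - intros [H1 H2] P [e He]. unfold filtermap.
    assert (E1 : F (fun t => ball (fst l) e (fst (f t)))) by (apply H1; now exists e).
    assert (E2 : F (fun t => ball (snd l) e (snd (f t)))) by (apply H2; now exists e).
    apply (filter_imp _ _ (fun t Ht => He (f t) Ht)).
    now apply filter_and.
Qed.

Lemma sum_n_fst (u : nat -> C) (N : nat) : fst (sum_n u N) = sum_n (fun n => fst (u n)) N.
Proof. induction N as [|N IH]; [now rewrite !sum_O | rewrite !sum_Sn, <- IH; reflexivity]. Qed.

Lemma sum_n_snd (u : nat -> C) (N : nat) : snd (sum_n u N) = sum_n (fun n => snd (u n)) N.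
Proof. induction N as [|N IH]; [now rewrite !sum_O | rewrite !sum_Sn, <- IH; reflexivity]. Qed.

Lemma series_conv_iff (u : nat -> C) (l : C) :
  series_conv u l <->
  is_series (fun n => fst (u n)) (fst l) /\ is_series (fun n => snd (u n)) (snd l).
Proof.
  unfold series_conv. rewrite (filterlim_C_iff eventually).
  split; intros [H1 H2]; split;
    (eapply filterlim_ext; [| eassumption]); intros N;
    (apply sum_n_fst || apply sum_n_snd || (symmetry; apply sum_n_fst || apply sum_n_snd)).
Qed.

Lemma series_conv_ext (u v : nat -> C) (l : C) :
  (forall n, u n = v n) -> series_conv u l -> series_conv v l.
Proof.
  intros H. apply filterlim_ext. intros N. now apply sum_n_ext.
Qed.

Lemma series_conv_unique (u : nat -> C) (l m : C) :
  series_conv u l -> series_conv u m -> l = m.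
Proof.
  rewrite !series_conv_iff. intros [H1 H2] [H3 H4].
  apply is_series_unique in H1, H2, H3, H4.
  apply injective_projections; congruence.
Qed.

Lemma fst_mult_RtoC (z : C) (x : R) : fst (z * RtoC x)%C = fst z * x.
Proof. simpl. ring. Qed.

Lemma snd_mult_RtoC (z : C) (x : R) : snd (z * RtoC x)%C = snd z * x.
Proof. simpl. ring. Qed.

Lemma series_conv_diff_scal (u v : nat -> C) (l m : C) (k : R) :
  series_conv u l -> series_conv v m ->
  series_conv (fun n => (u n - v n) * RtoC k)%C ((l - m) * RtoC k)%C.
Proof.
  assert (P : forall (f g : nat -> R) (x y : R), is_series f x -> is_series g y ->
    is_series (fun n => (f n - g n) * k) ((x - y) * k)).
  { intros f g x y Hf Hg. apply is_series_scal_r.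
    exact (is_series_minus (V := R_NormedModule) f g x y Hf Hg). }
  rewrite !series_conv_iff. intros [H1 H2] [H3 H4]. split.
  - rewrite fst_mult_RtoC. eapply is_series_ext; [| exact (P _ _ _ _ H1 H3)].
    intros n. now rewrite fst_mult_RtoC.
  - rewrite snd_mult_RtoC. eapply is_series_ext; [| exact (P _ _ _ _ H2 H4)].
    intros n. now rewrite snd_mult_RtoC.
Qed.

(** * One-sided limits and the summability notions in components *)

Definition right_lim (f : R -> R) (v : R) : Prop :=
  forall eps, 0 < eps -> exists d, 0 < d /\ forall h, 0 < h < d -> Rabs (f h - v) < eps.

Lemma right_lim_iff (f : R -> R) (v : R) :
  filterlim f (at_right 0) (locally v) <-> right_lim f v.
Proof.
  split.
  - intros H eps He.
    destruct (H (fun y => Rabs (y - v) < eps)) as [d Hd].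
    + exists (mkposreal eps He). intros y Hy. exact Hy.
    + exists d. split; [apply cond_pos |]. intros h Hh. apply Hd; [| lra].
      change (Rabs (h - 0) < d). rewrite Rabs_right; lra.
  - intros H P [e He]. destruct (H e (cond_pos e)) as [d [Hd Hf]].
    exists (mkposreal d Hd). intros h Hh Hh0. apply He. apply Hf.
    change (Rabs (h - 0) < d) in Hh. apply Rabs_def2 in Hh. lra.
Qed.

Lemma at_left_1_iff (f : R -> R) (v : R) :
  filterlim f (at_left 1) (locally v) <-> right_lim (fun h => f (exp (- h))) v.
Proof.
  split.
  - intros H eps He.
    destruct (H (fun y => Rabs (y - v) < eps)) as [d Hd].
    + exists (mkposreal eps He). intros y Hy. exact Hy.
    + exists d. split; [apply cond_pos |]. intros h Hh.
      pose proof (exp_ineq1_le (- h)).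
      assert (exp (- h) < 1) by (rewrite <- exp_0; apply exp_increasing; lra).
      apply Hd; [| assumption].
      change (Rabs (exp (- h) - 1) < d). rewrite Rabs_left; lra.
  - intros H P [e He]. destruct (H e (cond_pos e)) as [d [Hd Hf]].
    assert (Hed : exp (- d) < 1) by (rewrite <- exp_0; apply exp_increasing; lra).
    exists (mkposreal (1 - exp (- d)) ltac:(lra)). intros r Hr Hr1. apply He.
    change (Rabs (r - 1) < 1 - exp (- d)) in Hr. apply Rabs_def2 in Hr.
    pose proof (exp_pos (- d)).
    assert (E : exp (- - ln r) = r) by (rewrite Ropp_involutive; apply exp_ln; lra).
    rewrite <- E. apply Hf. split.
    + pose proof (ln_increasing r 1 ltac:(lra) Hr1) as Hl. rewrite ln_1 in Hl. lra.
    + pose proof (ln_increasing (exp (- d)) r ltac:(lra) ltac:(lra)) as Hl.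
      rewrite ln_exp in Hl. lra.
Qed.

Lemma right_lim_ext (f g : R -> R) (v d : R) : 0 < d ->
  (forall h, 0 < h < d -> f h = g h) -> right_lim f v -> right_lim g v.
Proof.
  intros Hd Hfg Hf eps He. destruct (Hf eps He) as [d1 [Hd1 H1]].
  exists (Rmin d d1). split; [now apply Rmin_pos |]. intros h Hh.
  pose proof (Rmin_l d d1). pose proof (Rmin_r d d1).
  rewrite <- Hfg by lra. apply H1. lra.
Qed.

(** Decay of [g] and [linear_mean] give convergence for every [h > 0], so the witness [h0 = 1] is
    arbitrary and only the limit has to be transferred. *)
Lemma riemann_summable_iff (g : R -> R) (c : nat -> C) (s : C) (K C1 : R) :
  linear_mean (fun n => fst (c n)) K -> linear_mean (fun n => snd (c n)) K ->
  admissible g C1 ->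
  riemann_summable g c s <->
  kernel_lim (fun n => fst (c n)) g (fst s) /\ kernel_lim (fun n => snd (c n)) g (snd s).
Proof.
  intros Hc1 Hc2 [_ [Hi _]].
  pose proof (kernel_ex_series _ _ _ _ Hc1 Hi) as E1.
  pose proof (kernel_ex_series _ _ _ _ Hc2 Hi) as E2.
  split.
  - intros [h0 [Hh0 [f [Hf Hlim]]]].
    apply (filterlim_C_iff (at_right 0)) in Hlim. destruct Hlim as [L1 L2].
    apply right_lim_iff in L1. apply right_lim_iff in L2.
    assert (Hs : forall h, 0 < h < h0 ->
      fst (f h) = kernel_sum (fun n => fst (c n)) g h /\
      snd (f h) = kernel_sum (fun n => snd (c n)) g h).
    { intros h Hh. specialize (Hf h Hh). apply series_conv_iff in Hf. destruct Hf as [F1 F2].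
      apply is_series_unique in F1. apply is_series_unique in F2.
      split; [rewrite <- F1 | rewrite <- F2]; apply Series_ext; intros n;
        [apply fst_mult_RtoC | apply snd_mult_RtoC]. }
    split; (split; [assumption |]).
    + apply right_lim_ext with (1 := Hh0) (3 := L1). intros h Hh. now apply Hs.
    + apply right_lim_ext with (1 := Hh0) (3 := L2). intros h Hh. now apply Hs.
  - intros [[_ L1] [_ L2]]. exists 1. split; [lra |].
    exists (fun h => (kernel_sum (fun n => fst (c n)) g h, kernel_sum (fun n => snd (c n)) g h)).
    split.
    + intros h Hh. apply series_conv_iff. split.
      * apply (is_series_ext (fun n => fst (c n) * g (INR n * h))).
        -- intros n. symmetry. apply fst_mult_RtoC.
        -- apply Series_correct, E1. lra.
      * apply (is_series_ext (fun n => snd (c n) * g (INR n * h))).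
        -- intros n. symmetry. apply snd_mult_RtoC.
        -- apply Series_correct, E2. lra.
    + apply (filterlim_C_iff (at_right 0)). split; now apply right_lim_iff.
Qed.

Lemma exp_kernel_pow (h : R) (n : nat) : exp (- (INR n * h)) = exp (- h) ^ n.
Proof. rewrite exp_pow_nat. f_equal. ring. Qed.

(** The substitution [r = exp(-h)] turns [r ^ n] into the exponential kernel at [n h]. *)
Lemma abel_summable_iff (c : nat -> C) (s : C) (K : R) :
  linear_mean (fun n => fst (c n)) K -> linear_mean (fun n => snd (c n)) K ->
  abel_summable c s <->
  kernel_lim (fun n => fst (c n)) (fun x => exp (- x)) (fst s) /\
  kernel_lim (fun n => snd (c n)) (fun x => exp (- x)) (snd s).
Proof.
  intros Hc1 Hc2. destruct exp_admissible as [_ [Hi _]].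
  pose proof (kernel_ex_series _ _ _ _ Hc1 Hi) as E1.
  pose proof (kernel_ex_series _ _ _ _ Hc2 Hi) as E2.
  assert (Hr : forall h, 0 < h -> 0 < exp (- h) < 1).
  { intros h Hh. split; [apply exp_pos |]. rewrite <- exp_0. apply exp_increasing. lra. }
  split.
  - intros [f [Hf Hlim]].
    apply (filterlim_C_iff (at_left 1)) in Hlim. destruct Hlim as [L1 L2].
    apply at_left_1_iff in L1. apply at_left_1_iff in L2.
    assert (Hs : forall h, 0 < h < 1 ->
      fst (f (exp (- h))) = kernel_sum (fun n => fst (c n)) (fun x => exp (- x)) h /\
      snd (f (exp (- h))) = kernel_sum (fun n => snd (c n)) (fun x => exp (- x)) h).
    { intros h Hh. specialize (Hf _ (Hr h ltac:(lra))). apply series_conv_iff in Hf.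
      destruct Hf as [F1 F2]. apply is_series_unique in F1. apply is_series_unique in F2.
      split; [rewrite <- F1 | rewrite <- F2]; apply Series_ext; intros n;
        rewrite exp_kernel_pow; [apply fst_mult_RtoC | apply snd_mult_RtoC]. }
    split; (split; [assumption |]).
    + apply right_lim_ext with (1 := Rlt_0_1) (3 := L1). intros h Hh. now apply Hs.
    + apply right_lim_ext with (1 := Rlt_0_1) (3 := L2). intros h Hh. now apply Hs.
  - intros [[_ L1] [_ L2]].
    exists (fun r => (kernel_sum (fun n => fst (c n)) (fun x => exp (- x)) (- ln r),
                      kernel_sum (fun n => snd (c n)) (fun x => exp (- x)) (- ln r))).
    split.
    + intros r Hr1.
      assert (Hh : 0 < - ln r).
      { pose proof (ln_increasing r 1 ltac:(lra) ltac:(lra)) as Hl. rewrite ln_1 in Hl. lra. }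
      assert (Hp : forall n, exp (- (INR n * - ln r)) = r ^ n).
      { intros n. rewrite exp_kernel_pow, Ropp_involutive, exp_ln by lra. reflexivity. }
      apply series_conv_iff. split.
      * apply (is_series_ext (fun n => fst (c n) * exp (- (INR n * - ln r)))).
        -- intros n. rewrite Hp. symmetry. apply fst_mult_RtoC.
        -- now apply Series_correct, E1.
      * apply (is_series_ext (fun n => snd (c n) * exp (- (INR n * - ln r)))).
        -- intros n. rewrite Hp. symmetry. apply snd_mult_RtoC.
        -- now apply Series_correct, E2.
    + apply (filterlim_C_iff (at_left 1)). split; apply at_left_1_iff; simpl.
      * apply right_lim_ext with (1 := Rlt_0_1) (3 := L1). intros h Hh.
        now rewrite ln_exp, Ropp_involutive.
      * apply right_lim_ext with (1 := Rlt_0_1) (3 := L2). intros h Hh.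
        now rewrite ln_exp, Ropp_involutive.
Qed.

Lemma cesaro_summable_iff (beta : R) (c : nat -> C) (s : C) : 0 < beta ->
  cesaro_summable beta c s <->
  is_lim_seq (cesaro_mean beta (fun n => fst (c n))) (fst s) /\
  is_lim_seq (cesaro_mean beta (fun n => snd (c n))) (snd s).
Proof.
  intros Hb. unfold cesaro_summable. rewrite (filterlim_C_iff eventually).
  assert (D : forall (z : C) (x : R), 0 < x ->
    fst (z / RtoC x)%C = fst z / x /\ snd (z / RtoC x)%C = snd z / x).
  { intros z x Hx. assert (E : (z / RtoC x)%C = (z * RtoC (/ x))%C).
    { unfold Cdiv. now rewrite RtoC_inv by lra. }
    rewrite E, fst_mult_RtoC, snd_mult_RtoC. split; reflexivity. }
  assert (F : forall n,
    fst (sum_n (fun k => RtoC (cesA beta (n - k)) * c k) n / RtoC (cesA beta n))%C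
    = cesaro_mean beta (fun n => fst (c n)) n).
  { intros n. rewrite (proj1 (D _ _ (cesA_pos beta n Hb))), sum_n_fst.
    unfold cesaro_mean. f_equal. apply sum_n_ext. intros k. simpl. ring. }
  assert (G : forall n,
    snd (sum_n (fun k => RtoC (cesA beta (n - k)) * c k) n / RtoC (cesA beta n))%C
    = cesaro_mean beta (fun n => snd (c n)) n).
  { intros n. rewrite (proj2 (D _ _ (cesA_pos beta n Hb))), sum_n_snd.
    unfold cesaro_mean. f_equal. apply sum_n_ext. intros k. simpl. ring. }
  split; intros [H1 H2]; split.
  - exact (filterlim_ext _ _ F H1).
  - exact (filterlim_ext _ _ G H2).
  - exact (filterlim_ext _ _ (fun n => eq_sym (F n)) H1).
  - exact (filterlim_ext _ _ (fun n => eq_sym (G n)) H2).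
Qed.

(** * Equivalences with Abel summability for real sequences *)

Lemma abel_iff_gamma1 (c : nat -> R) (K s : R) : linear_mean c K ->
  kernel_lim c (fun x => exp (- x)) s <-> kernel_lim c gamma1 s.
Proof.
  intros Hc. split; intros H.
  - apply (kernel_lim_transfer c K 1 1 s (fun x => exp (- x))); try assumption.
    + exact exp_admissible.
    + exact gamma1_admissible.
    + intros d Y. now apply exp_frame with s.
  - apply (kernel_lim_transfer c K 1 1 s gamma1); try assumption.
    + exact gamma1_admissible.
    + exact exp_admissible.
    + intros d Y. now apply gamma1_frame with s.
Qed.

Lemma abel_iff_gamma2 (c : nat -> R) (K s : R) : linear_mean c K ->
  kernel_lim c (fun x => exp (- x)) s <-> kernel_lim c gamma2 s.
Proof.
  intros Hc. split; intros H.
  - apply (kernel_lim_transfer c K 1 2 s (fun x => exp (- x))); try assumption.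
    + exact exp_admissible.
    + exact gamma2_admissible.
    + intros d Y. now apply exp_frame with s.
  - apply (kernel_lim_transfer c K 2 1 s gamma2); try assumption.
    + exact gamma2_admissible.
    + exact exp_admissible.
    + intros d Y. now apply gamma2_frame with s.
Qed.

Lemma abel_iff_cesaro (c : nat -> R) (K beta s : R) : linear_mean c K -> 0 < beta ->
  kernel_lim c (fun x => exp (- x)) s <-> is_lim_seq (cesaro_mean beta c) s.
Proof.
  intros Hc Hb. split; intros H.
  - apply (cesaro_of_riesz c K); try assumption.
    apply (kernel_lim_transfer c K 1 (2 * beta + 2) s (fun x => exp (- x))); try assumption.
    + exact exp_admissible.
    + now apply riesz_admissible.
    + intros d Y. now apply exp_frame with s.
  - now apply (abel_of_cesaro c K beta).
Qed.

(** * From the hypothesis on [rho] to the components of the terms *)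

Lemma linear_mean_rho (a b : nat -> C) :
  (exists K : R, exists M : nat, forall N : nat, (M <= N)%nat ->
     sum_n (fun n => INR n * rho a b n) N <= K * INR N) ->
  exists K, linear_mean (rho a b) K.
Proof.
  intros [K [M HM]].
  assert (Hrho : forall n, 0 <= rho a b n) by (intros n; apply sqrt_pos).
  set (T := sum_n (fun n => INR n * rho a b n)).
  assert (Hstep : forall n, T n <= T (S n)).
  { intros n. unfold T. rewrite sum_n_RS. specialize (Hrho (S n)).
    pose proof (pos_INR (S n)). nra. }
  assert (Hmono : forall n m, (n <= m)%nat -> T n <= T m).
  { intros n m Hnm. induction Hnm as [|m Hnm IH]; [lra |]. specialize (Hstep m). lra. }
  assert (HT0 : T 0%nat = 0) by (unfold T; rewrite sum_O; simpl; ring).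
  (* Below the threshold, [T N <= T M <= T M * N] for [N >= 1], and [T 0 = 0]. [Rabs K] avoids
     proving [K >= 0]. *)
  exists (Rabs K + T M). intros N.
  replace (sum_n (fun n => INR n * Rabs (rho a b n)) N) with (T N).
  2: { apply sum_n_ext. intros n. now rewrite (Rabs_right (rho a b n)) by (apply Rle_ge, Hrho). }
  pose proof (Hmono 0%nat M ltac:(lia)). pose proof (Rle_abs K). pose proof (Rabs_pos K).
  destruct N as [|N]; [rewrite HT0; simpl; lra |].
  assert (HN : 1 <= INR (S N)) by (rewrite S_INR; pose proof (pos_INR N); lra).
  destruct (Nat.le_gt_cases M (S N)) as [HMN | HMN].
  - specialize (HM (S N) HMN). fold T in HM. nra.
  - specialize (Hmono (S N) M ltac:(lia)). nra.
Qed.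

(** Positive indices suffice since index 0 has weight 0; the zeroth term [a 0 / 2] follows a
    different formula. *)
Lemma linear_mean_le (c u : nat -> R) (K k : R) :
  linear_mean u K -> 0 <= k -> (forall n, Rabs (c (S n)) <= k * Rabs (u (S n))) ->
  linear_mean c (k * K).
Proof.
  intros Hu Hk H N.
  apply Rle_trans with (k * sum_n (fun n => INR n * Rabs (u n)) N).
  - rewrite !sum_n_Reals, scal_sum. apply sum_Rle. intros [|n] _; [simpl; lra |].
    specialize (H n). pose proof (pos_INR (S n)). nra.
  - specialize (Hu N). nra.
Qed.

Lemma Cmod_le_rho (a b : nat -> C) (n : nat) :
  Cmod (a n) <= rho a b n /\ Cmod (b n) <= rho a b n.
Proof.
  pose proof (Cmod_ge_0 (a n)). pose proof (Cmod_ge_0 (b n)). unfold rho.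
  split.
  - rewrite <- (sqrt_pow2 (Cmod (a n))) at 1 by assumption. apply sqrt_le_1_alt. nra.
  - rewrite <- (sqrt_pow2 (Cmod (b n))) at 1 by assumption. apply sqrt_le_1_alt. nra.
Qed.

Lemma components_le_rho (a b : nat -> C) (n : nat) (p q : R) :
  Rabs p <= 1 -> Rabs q <= 1 ->
  Rabs (fst (a n * RtoC p + b n * RtoC q)%C) <= 2 * rho a b n /\
  Rabs (snd (a n * RtoC p + b n * RtoC q)%C) <= 2 * rho a b n.
Proof.
  intros Hp Hq. destruct (Cmod_le_rho a b n) as [Ha Hb].
  assert (H : Cmod (a n * RtoC p + b n * RtoC q)%C <= 2 * rho a b n).
  { apply Rle_trans with (1 := Cmod_triangle _ _). rewrite !Cmod_mult, !Cmod_R.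
    pose proof (Cmod_ge_0 (a n)). pose proof (Cmod_ge_0 (b n)).
    pose proof (Rabs_pos p). pose proof (Rabs_pos q). nra. }
  pose proof (Rmax_Cmod (a n * RtoC p + b n * RtoC q)%C) as HM.
  set (z := (a n * RtoC p + b n * RtoC q)%C) in *.
  pose proof (Rmax_l (Rabs (fst z)) (Rabs (snd z))).
  pose proof (Rmax_r (Rabs (fst z)) (Rabs (snd z))). lra.
Qed.

Lemma cterm_linear_mean (a b : nat -> C) (x0 K : R) :
  linear_mean (rho a b) K ->
  linear_mean (fun n => fst (cterm a b x0 n)) (2 * K) /\
  linear_mean (fun n => snd (cterm a b x0 n)) (2 * K).
Proof.
  intros HK.
  assert (H : forall n, Rabs (fst (cterm a b x0 (S n))) <= 2 * Rabs (rho a b (S n)) /\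
                        Rabs (snd (cterm a b x0 (S n))) <= 2 * Rabs (rho a b (S n))).
  { intros n. rewrite (Rabs_right (rho a b (S n))) by (apply Rle_ge, sqrt_pos).
    apply components_le_rho; apply Rabs_le; [apply COS_bound | apply SIN_bound]. }
  split; apply (linear_mean_le _ (rho a b)); try lra; try assumption; intros n; apply H.
Qed.

(** * The integrated series and Lebesgue summability *)

Lemma Lterm_conv (a b : nat -> C) (K : R) : linear_mean (rho a b) K ->
  exists L : R -> C, forall x, series_conv (Lterm a b x) (L x).
Proof.
  intros HK.
  (* The series of [rho n / n], which dominates the integrated series for every [x], is the kernel
     sum of [1/x] at [h = 1]. *)
  assert (E0 : ex_series (fun n => rho a b n * / (INR n * 1))).
  { apply (kernel_ex_series (rho a b) K 1 Rinv HK); [| lra]. intros x Hx.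
    rewrite Rabs_right by (left; now apply Rinv_0_lt_compat). unfold Rdiv. lra. }
  apply ex_series_incr_1 in E0.
  assert (E1 : ex_series (fun n => 2 * (rho a b (S n) * / (INR (S n) * 1)))).
  { exact (ex_series_scal (V := R_NormedModule) 2 _ E0). }
  assert (Hb : forall x n,
    Rabs (fst (Lterm a b x (S n))) <= 2 * (rho a b (S n) * / (INR (S n) * 1)) /\
    Rabs (snd (Lterm a b x (S n))) <= 2 * (rho a b (S n) * / (INR (S n) * 1))).
  { intros x n. set (m := S n). pose proof (lt_0_INR m ltac:(unfold m; lia)) as Hm.
    assert (Hi : 0 < / INR m) by now apply Rinv_0_lt_compat.
    set (z := (a m * RtoC (sin (INR m * x)) + b m * RtoC (- cos (INR m * x)))%C).
    assert (E : Lterm a b x m = (z * RtoC (/ INR m))%C).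
    { unfold z, m, Lterm. fold m. rewrite RtoC_inv, RtoC_opp by lra. field.
      intros F. apply RtoC_inj in F. lra. }
    rewrite E, fst_mult_RtoC, snd_mult_RtoC, Rmult_1_r, !Rabs_mult, (Rabs_right (/ INR m)) by lra.
    destruct (components_le_rho a b m (sin (INR m * x)) (- cos (INR m * x))) as [B1 B2].
    - apply Rabs_le, SIN_bound.
    - rewrite Rabs_Ropp. apply Rabs_le, COS_bound.
    - fold z in B1, B2. split; nra. }
  exists (fun x => (Series (fun n => fst (Lterm a b x n)), Series (fun n => snd (Lterm a b x n)))).
  intros x. apply series_conv_iff. split.
  - apply (Series_correct (fun n => fst (Lterm a b x n))), ex_series_incr_1.
    apply ex_series_Rabs_le with (2 := E1). intros n. apply Hb.
  - apply (Series_correct (fun n => snd (Lterm a b x n))), ex_series_incr_1.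
    apply ex_series_Rabs_le with (2 := E1). intros n. apply Hb.
Qed.

(** From [sin (m (x0 + h)) - sin (m (x0 - h)) = 2 cos (m x0) sin (m h)] and its cosine analogue;
    dividing by [2 m h] produces [gamma1 (m h)]. The zeroth term fits because [gamma1 0 = 1]. *)
Lemma Lterm_symmetric_diff (a b : nat -> C) (x0 h : R) (n : nat) : h <> 0 ->
  ((Lterm a b (x0 + h) n - Lterm a b (x0 - h) n) * RtoC (/ (2 * h)))%C
  = (cterm a b x0 n * RtoC (gamma1 (INR n * h)))%C.
Proof.
  intros Hh. destruct n as [|n].
  - replace (INR 0 * h) with 0 by (simpl; ring). rewrite gamma1_0. unfold Lterm, cterm.
    replace (x0 + h) with (x0 - h + 2 * h) by ring.
    replace ((x0 - h + 2 * h) / 2) with ((x0 - h) / 2 + h) by field.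
    rewrite RtoC_plus. rewrite RtoC_inv, RtoC_mult by lra. field.
    intros F. apply RtoC_inj in F. lra.
  - unfold Lterm, cterm. set (m := INR (S n)).
    assert (Hm : m <> 0) by (unfold m; apply not_0_INR; lia).
    unfold gamma1. destruct Req_EM_T as [E | E]; [apply Rmult_integral in E; tauto |].
    replace (m * (x0 + h)) with (m * x0 + m * h) by ring.
    replace (m * (x0 - h)) with (m * x0 - m * h) by ring.
    rewrite sin_plus, sin_minus, cos_plus, cos_minus.
    unfold Rdiv. rewrite ?RtoC_plus, ?RtoC_minus, ?RtoC_mult, ?RtoC_inv
      by (try apply Rmult_integral_contrapositive; lra).
    rewrite ?RtoC_plus, ?RtoC_minus, ?RtoC_mult. field.
    split; intros F; apply RtoC_inj in F; lra.
Qed.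

Lemma lebesgue_iff_riemann (a b : nat -> C) (K x0 : R) (s : C) :
  linear_mean (rho a b) K ->
  lebesgue_summable a b x0 s <-> riemann_summable gamma1 (cterm a b x0) s.
Proof.
  intros HK.
  assert (Conv : forall h (l m : C), h <> 0 ->
    series_conv (Lterm a b (x0 + h)) l -> series_conv (Lterm a b (x0 - h)) m ->
    series_conv (fun n => cterm a b x0 n * RtoC (gamma1 (INR n * h)))%C ((l - m) / RtoC (2 * h))%C).
  { intros h l m Hh Hl Hm. unfold Cdiv. rewrite <- RtoC_inv by lra.
    apply (series_conv_ext
      (fun n => (Lterm a b (x0 + h) n - Lterm a b (x0 - h) n) * RtoC (/ (2 * h)))%C).
    - intros n. now apply Lterm_symmetric_diff.
    - now apply series_conv_diff_scal. }
  split.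
  - intros [delta [Hd [L [HL Hlim]]]]. exists delta. split; [assumption |].
    exists (fun h => Cdiv (Cminus (L (x0 + h)) (L (x0 - h))) (RtoC (2 * h))). split.
    + intros h Hh. apply Conv; [lra | |]; apply HL.
      * replace (x0 + h - x0) with h by ring. rewrite Rabs_right; lra.
      * replace (x0 - h - x0) with (- h) by ring. rewrite Rabs_Ropp, Rabs_right; lra.
    + apply filterlim_filter_le_1 with (2 := Hlim). intros P [e He]. exists e.
      intros y Hy Hy0. apply He; [assumption | lra].
  - intros [h0 [Hh0 [f [Hf Hlim]]]]. destruct (Lterm_conv a b K HK) as [L HL].
    exists 1. split; [lra |]. exists L. split; [intros x _; apply HL |].
    (* The symmetric quotient is even in [h], so the one-sided limit of [f] yields the two-sided
       one. *)
    apply (filterlim_ext_loc (fun h => f (Rabs h))).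
    + exists (mkposreal h0 Hh0). intros h Hh Hn0.
      change (Rabs (h - 0) < h0) in Hh. rewrite Rminus_0_r in Hh.
      pose proof (Rabs_pos_lt h Hn0) as Hp.
      rewrite (series_conv_unique _ _ _ (Hf (Rabs h) (conj Hp Hh))
                 (Conv (Rabs h) _ _ (Rgt_not_eq _ _ Hp) (HL _) (HL _))).
      unfold Rabs. destruct Rcase_abs; [| reflexivity].
      replace (x0 + - h) with (x0 - h) by ring. replace (x0 - - h) with (x0 + h) by ring.
      replace (2 * - h) with (- (2 * h)) by ring. rewrite RtoC_opp. field.
      intros F. apply RtoC_inj in F. lra.
    + apply filterlim_comp with (2 := Hlim). exact filterlim_Rabs_0.
Qed.

Theorem theorem1p3 (a b : nat -> C)
  (Hrho : exists K : R, exists M : nat, forall N : nat, (M <= N)%nat ->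
            sum_n (fun n => INR n * rho a b n) N <= K * INR N)
  (x0 : R) (s : C) (beta : R) (Hbeta : 0 < beta) :
  (lebesgue_summable a b x0 s <-> abel_summable (cterm a b x0) s) /\
  (lebesgue_summable a b x0 s <-> cesaro_summable beta (cterm a b x0) s) /\
  (lebesgue_summable a b x0 s <-> riemann_summable gamma1 (cterm a b x0) s) /\
  (lebesgue_summable a b x0 s <-> riemann_summable gamma2 (cterm a b x0) s).
Proof.
  destruct (linear_mean_rho a b Hrho) as [K HK].
  destruct (cterm_linear_mean a b x0 K HK) as [H1 H2].
  set (c := cterm a b x0) in *.
  pose proof (lebesgue_iff_riemann a b K x0 s HK) as HL. fold c in HL.
  pose proof (riemann_summable_iff gamma1 c s _ _ H1 H2 gamma1_admissible) as HR1.
  pose proof (riemann_summable_iff gamma2 c s _ _ H1 H2 gamma2_admissible) as HR2.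
  pose proof (abel_summable_iff c s _ H1 H2) as HA.
  pose proof (cesaro_summable_iff beta c s Hbeta) as HC.
  pose proof (abel_iff_gamma1 _ _ (fst s) H1). pose proof (abel_iff_gamma1 _ _ (snd s) H2).
  pose proof (abel_iff_gamma2 _ _ (fst s) H1). pose proof (abel_iff_gamma2 _ _ (snd s) H2).
  pose proof (abel_iff_cesaro _ _ beta (fst s) H1 Hbeta).
  pose proof (abel_iff_cesaro _ _ beta (snd s) H2 Hbeta).
  tauto.
Qed.
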